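(* Let $G$ be a simple bipartite graph on the vertex set $\{1,\ldots,n\}$. Then the initial ideal of $P_{G}$ with respect to any term order is generated by squarefree monomials. Furthermore, the equality $U(P_{G})=\mathcal{C}(I_{A_{G}})$ holds, i.e. the universal Gröbner basis of $P_G$ is equal to the set of circuits of the toric ideal $I_{A_G}$.
   Context: $K$ is a field. A simple graph is a finite undirected graph without loops or multiple edges. Let $G$ be a simple graph on $\{1,\ldots,n\}$ with edges $z_1,\ldots,z_m$. Let $S=K[\{x_{ij},x_{ji} : \{i,j\}\in E(G)\}\cup\{x_{ii}\}_{1\le i\le n}]$, a polynomial ring in $2m+n$ variables. For $i<j$ put $f_{ij}=x_{ii}x_{jj}-x_{ij}x_{ji}$; $P_G\subset S$ is the ideal generated by all $f_{ij}$ with $\{i,j\}\in E(G)$. Vector configuration $A_G$: let ${\bf e}_1,\ldots,{\bf e}_{n+m}$ be the canonical basis of $\mathbb{Z}^{n+m}$. For an edge $z_h=\{k,l\}$ with $k<l$, let ${\bf a}_{\{k,l\}}={\bf e}_k+{\bf e}_l-{\bf e}_{n+h}$ (attached to the variable $x_{kl}$) and ${\bf b}_{\{k,l\}}={\bf e}_{n+h}$ (attached to $x_{lk}$); for $1\le j\le n$ let ${\bf a}_{jj}={\bf e}_j$ (attached to $x_{jj}$). $A_G$ consists of these $2m+n$ vectors. The toric ideal $I_{A_G}\subset S$ is the kernel of the $K$-algebra homomorphism $S\to K[t_1^{\pm1},\ldots,t_{n+m}^{\pm1}]$ sending each variable to ${\bf t}^{{\bf a}}$, where ${\bf a}$ is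 the vector attached to the variable. A binomial is a difference of two monomials; its support is the set of variables occurring in it. A circuit of $I_{A_G}$ is an irreducible binomial $B\in I_{A_G}$ such that no (nonzero) binomial $B'\in I_{A_G}$ has ${\rm supp}(B')\subsetneqq{\rm supp}(B)$; $\mathcal{C}(I_{A_G})$ is the set of circuits. The universal Gröbner basis $U(I)$ of an ideal $I$ generated by binomials is the union of all its reduced Gröbner bases (over all term orders). Binomials are identified up to sign. *)

(* Defs.v *)
From mathcomp Require Import all_boot all_order all_algebra.
From mathcomp Require Import mpoly.

Set Implicit Arguments.
Unset Strict Implicit.
Unset Printing Implicit Defensive.

Import GRing.Theory.
Local Open Scope ring_scope.

(* Subsets of a ring, in particular ideals, are Prop-valued predicates, and
   equality of such subsets is stated extensionally. *)

Definition ideal_gen (R : comNzRingType) (F : R -> Prop) (p : R) : Prop :=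
  exists2 s : seq (R * R),
    forall c, c \in s -> F c.2 & p = \sum_(c <- s) c.1 * c.2.

Definition irreducible (R : unitRingType) (p : R) : Prop :=
  [/\ p != 0, p \isn't a GRing.unit
    & forall q r, p = q * r -> q \is a GRing.unit \/ r \is a GRing.unit].

Definition up_to_sign (R : nzRingType) (F : R -> Prop) (p : R) : Prop :=
  F p \/ F (- p).

Section Groebner.
Variables (K : fieldType) (N : nat).
Implicit Types (le : rel 'X_{1..N}) (I : {mpoly K[N]} -> Prop)
  (p q : {mpoly K[N]}) (m : 'X_{1..N}).

Record term_order le : Prop := TermOrder {
  term_order_refl : reflexive le;
  term_order_anti : antisymmetric le;
  term_order_trans : transitive le;
  term_order_total : total le;
  term_order_min : forall m, le 0%MM m;
  term_order_add : forall m m1 m2, le m1 m2 -> le (m + m1)%MM (m + m2)%MM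
}.

(* The zero polynomial has no leading monomial. *)
Definition leading_monomial le p m : Prop :=
  m \in msupp p /\ forall m', m' \in msupp p -> le m' m.

Definition monomial_ideal (M : 'X_{1..N} -> Prop) : {mpoly K[N]} -> Prop :=
  ideal_gen (fun p => exists2 m, M m & p = 'X_[m]).

Definition initial_ideal le I : {mpoly K[N]} -> Prop :=
  monomial_ideal (fun m => exists2 p, I p & leading_monomial le p m).

Definition squarefree_monomial m : Prop := forall i, (m i <= 1)%N.

Definition generated_by_squarefree_monomials I : Prop :=
  exists2 M : 'X_{1..N} -> Prop,
    forall m, M m -> squarefree_monomial m
    & forall p, I p <-> monomial_ideal M p.

Record groebner_basis le I (B : seq {mpoly K[N]}) : Prop := GroebnerBasis {
  groebner_sub : forall g, g \in B -> I g;
  groebner_neq0 : forall g, g \in B -> g != 0;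
  groebner_initial : forall p, initial_ideal le I p <->
    monomial_ideal (fun m => exists2 g, g \in B & leading_monomial le g m) p
}.

(* [(m <= m')%MM] is divisibility of monomials. *)
Record reduced_groebner_basis le I (B : seq {mpoly K[N]}) : Prop :=
  ReducedGroebnerBasis {
  reduced_groebner : groebner_basis le I B;
  reduced_monic : forall g m, g \in B -> leading_monomial le g m -> g@_m = 1;
  reduced_ndiv : forall g h m m', g \in B -> h \in B -> g != h ->
    leading_monomial le h m -> m' \in msupp g -> ~~ (m <= m')%MM
}.

Definition universal_groebner_basis I p : Prop :=
  exists le, exists B : seq {mpoly K[N]},
    [/\ term_order le, reduced_groebner_basis le I B & p \in B].

Definition binomial p : Prop :=
  exists u v : 'X_{1..N}, p = 'X_[u] - 'X_[v].

Definition vars p : {set 'I_N} :=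
  [set i | has (fun m : 'X_{1..N} => (0 < m i)%N) (msupp p)].

Definition circuit I p : Prop :=
  [/\ binomial p, irreducible p, I p
    & forall q, binomial q -> q != 0 -> I q -> ~~ (vars q \proper vars p)].

(* The Laurent polynomial ring K[t_1^{+-1}, ..., t_d^{+-1}] is viewed inside
   the field of fractions K(t_1, ..., t_d); this does not change the kernel. *)
Definition laurent_const d (c : K) : {fraction {mpoly K[d]}} := tofrac c%:MP.

Definition laurent_monomial d (a : 'rV[int]_d) : {fraction {mpoly K[d]}} :=
  \prod_(i < d) tofrac ('X_i : {mpoly K[d]}) ^ (a 0 i).

Definition toric_ideal d (A : 'I_N -> 'rV[int]_d) p : Prop :=
  mmap (@laurent_const d) (fun v => laurent_monomial (A v)) p = 0.

End Groebner.

(* A simple graph on n vertices with labelled edges z_1, ..., z_m: the edge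
   {k, l} with k < l is stored as the pair (k, l). *)
Record sgraph (n m : nat) := SGraph {
  edge : 'I_m -> 'I_n * 'I_n;
  edge_lt : forall h, ((edge h).1 < (edge h).2)%N;
  edge_inj : injective edge
}.

Definition bipartite n m (G : sgraph n m) : Prop :=
  exists V : {set 'I_n},
    forall h, ((edge G h).1 \in V) != ((edge G h).2 \in V).

(* For the edge z_h = {k, l} with k < l, [var_up h] is the index of the
   variable x_kl and [var_low h] that of x_lk; [var_diag j] is that of x_jj. *)
Section MatrixVariables.
Variables n m : nat.
Definition var_diag (j : 'I_n) : 'I_(n + (m + m)) := lshift (m + m) j.
Definition var_up (h : 'I_m) : 'I_(n + (m + m)) := rshift n (lshift m h).
Definition var_low (h : 'I_m) : 'I_(n + (m + m)) := rshift n (rshift m h).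
End MatrixVariables.
Arguments var_diag {n} m j.
Arguments var_up n {m} h.
Arguments var_low n {m} h.

Section GraphIdeals.
Variables (K : fieldType) (n m : nat) (G : sgraph n m).

Definition edge_minor (h : 'I_m) : {mpoly K[n + (m + m)]} :=
  'X_(var_diag m (edge G h).1) * 'X_(var_diag m (edge G h).2)
  - 'X_(var_up n h) * 'X_(var_low n h).

Definition P_ideal : {mpoly K[n + (m + m)]} -> Prop :=
  ideal_gen (fun p => exists h, p = edge_minor h).

Definition basis_vec (i : 'I_(n + m)) : 'rV[int]_(n + m) := delta_mx 0 i.

Definition A_config (v : 'I_(n + (m + m))) : 'rV[int]_(n + m) :=
  match split v with
  | inl j => basis_vec (lshift m j)
  | inr w =>
    match split w with
    | inl h => basis_vec (lshift m (edge G h).1) + basis_vec (lshift m (edge G h).2)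
               - basis_vec (rshift n h)
    | inr h => basis_vec (rshift n h)
    end
  end.

End GraphIdeals.
Arguments P_ideal K {n m} G p.

Lemma A_config_diag n m (G : sgraph n m) j :
  A_config G (var_diag m j) = basis_vec (lshift m j).
Proof. by rewrite /A_config /var_diag (unsplitK (inl j)). Qed.

Lemma A_config_up n m (G : sgraph n m) h :
  A_config G (var_up n h) = basis_vec (lshift m (edge G h).1)
    + basis_vec (lshift m (edge G h).2) - basis_vec (rshift n h).
Proof.
by rewrite /A_config /var_up (unsplitK (inr (lshift m h))) (unsplitK (inl h)).
Qed.

Lemma A_config_low n m (G : sgraph n m) h :
  A_config G (var_low n h) = basis_vec (rshift n h).
Proof.
by rewrite /A_config /var_low (unsplitK (inr (rshift m h))) (unsplitK (inr h)).
Qed.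

(* Main.v *)
Require Import Defs.
From HB Require Import structures.
From mathcomp Require Import all_boot all_order all_algebra.
From mathcomp Require Import mpoly.
From mathcomp Require Import zify.

Set Implicit Arguments.
Unset Strict Implicit.
Unset Printing Implicit Defensive.

Import Order.TTheory GRing.Theory Num.Theory.
Local Open Scope ring_scope.

(** For a bipartite graph the ideal of edge minors is a toric ideal I_A, and the
    configuration A is unimodular; the theorem holds for every homogeneous
    unimodular configuration.

    Lattice. A vector of the kernel lattice of A is represented by a pair (u, v) of
    monomials of the same multidegree. Unimodularity is used in the following form:
    every nonzero lattice vector dominates, sign by sign, a nonzero lattice vector
    with entries 0, 1, -1. From this, every lattice vector dominates an elementary
    one, that is, one with entries 0, 1, -1 and minimal support
    ([elementary_pair_exists]), and the lattice vectors supported on an elementary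
    one are its multiples ([elementary_pair_multiple]).

    Groebner bases. The elements of I_A have at least two monomials in each fibre of
    the multidegree that they meet ([toric_ideal_partner]), so the initial ideal
    consists of the monomials that are not smallest in their fibre. Such a monomial
    u is divisible by the positive part of an elementary vector below u - v, where v
    is the smallest monomial of the fibre; this part is squarefree, which gives the
    first assertion ([initial_ideal_squarefree]). In the same way the elements of a
    reduced Groebner basis are binomials of elementary vectors
    ([reduced_groebner_element], [minimal_standard_elementary]). Conversely, the
    binomial of an elementary vector belongs to the reduced Groebner basis for an
    order that eliminates the variables outside its support
    ([elementary_pair_elimination], [reduced_groebner_exists]).

    Circuits. The binomials of elementary vectors are exactly the circuits: they are
    irreducible since their terms are squarefree and coprime
    ([squarefree_binomial_irreducible]), and an irreducible binomial of minimal
    support cannot be a proper multiple of an elementary vector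
    ([circuit_elementary_pair]).

    Graphs. Exchanging x_kl x_lk for x_kk x_ll connects any two monomials of a fibre,
    so the ideal of edge minors is I_A ([P_idealE]). If G is bipartite, orienting all
    edges from one side to the other and joining each vertex to a point at infinity
    turns lattice vectors into circulations; a circulation contains a union of
    directed cycles, which gives unimodularity ([bipartite_unimodular]). *)

(** * Lattice vectors as pairs of monomials *)

Section Configuration.
Variables (N d : nat) (A : 'I_N -> 'rV[int]_d).
Implicit Types u v w m : 'X_{1..N}.

(** The monomial of exponent u is sent to the Laurent monomial of exponent
    [mnm_deg u]. *)
Definition mnm_deg u : 'rV[int]_d := \sum_i A i *+ u i.

Lemma mnm_degD u v : mnm_deg (u + v)%MM = mnm_deg u + mnm_deg v.
Proof.
by rewrite -big_split; apply: eq_bigr => i _; rewrite mnmDE mulrnDr.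
Qed.

Lemma mnm_deg_swap u v u' v' : mnm_deg u = mnm_deg v ->
  (u + v')%MM = (v + u')%MM -> mnm_deg u' = mnm_deg v'.
Proof.
by move=> uv /(congr1 mnm_deg); rewrite !mnm_degD uv => /addrI.
Qed.

(** Truncated subtraction in both directions removes the common factor of two
    monomials: (u - v, v - u) is the coprime pair representing the lattice
    vector of (u, v). *)
Lemma mnm_deg_sub u v : mnm_deg u = mnm_deg v -> mnm_deg (u - v) = mnm_deg (v - u).
Proof.
move=> /mnm_deg_swap; apply; apply/mnmP => i; rewrite !mnmDE !mnmBE; lia.
Qed.

Lemma mnm_deg_muln u v k : mnm_deg u = mnm_deg v -> mnm_deg (u *+ k) = mnm_deg (v *+ k).
Proof.
by move=> uv; elim: k => [|k IH]; rewrite ?mulm0n // !mulmS !mnm_degD uv IH.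
Qed.

Lemma subm_neq u v : u != v -> (u - v)%MM != (v - u)%MM.
Proof.
apply: contra => /eqP/mnmP uv; apply/eqP/mnmP => i.
by move: (uv i); rewrite !mnmBE; lia.
Qed.

(** A pair (u, v) of monomials of equal multidegree represents the vector u - v
    of the kernel lattice of A. A squarefree pair is a vector with entries 0, 1
    and -1, split into its positive and negative parts. *)
Definition squarefree_pair u v := forall i, (u i + v i <= 1)%N.

Definition support_sub u v u' v' :=
  forall i, (u' i + v' i = 0)%N -> (u i + v i = 0)%N.

Definition homogeneous_config := 
  forall u v, mnm_deg u = mnm_deg v -> mdeg u = mdeg v.

(** The consequence of unimodularity on which everything rests: a nonzero vector
    of the kernel lattice dominates, sign by sign, a nonzero vector of the lattice
    with entries 0, 1 and -1. *)
Definition unimodular_config := forall u v, mnm_deg u = mnm_deg v -> u != v ->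
  exists u' v', [/\ (u' <= u)%MM, (v' <= v)%MM, u' != v', mnm_deg u' = mnm_deg v'
    & squarefree_pair u' v'].

(** The vectors of the kernel lattice with minimal support and entries 0, 1, -1;
    they are the exponents of the circuits. *)
Definition elementary_pair u v :=
  [/\ u != v, mnm_deg u = mnm_deg v, squarefree_pair u v &
    forall u' v', u' != v' -> mnm_deg u' = mnm_deg v' ->
      support_sub u' v' u v -> support_sub u v u' v'].

Lemma elementary_pairC u v : elementary_pair u v -> elementary_pair v u.
Proof.
case=> neq deg_eq sqf min; split=> //; first by rewrite eq_sym.
  by move=> i; rewrite addnC.
move=> u' v' neq' deg_eq' sub i zi; rewrite addnC.
by apply: min zi => // j; rewrite addnC => /sub.
Qed.

Hypothesis uniA : unimodular_config.

(** A squarefree pair of smallest degree below (u, v) has minimal support: if a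
    lattice vector had a strictly smaller support, it could be chosen with entries
    0, 1, -1, and adding it to the pair with the sign that cancels a common entry
    would leave a nonzero vector with the same signs, hence again a smaller
    squarefree pair. *)
Lemma elementary_pair_exists u v : mnm_deg u = mnm_deg v -> u != v ->
  exists c e, [/\ elementary_pair c e, (c <= u)%MM & (e <= v)%MM].
Proof.
move=> deg_uv neq_uv.
pose K := (mdeg u + mdeg v).+1.
have bound x y : (x <= u)%MM -> (y <= v)%MM -> (mdeg x < K)%N /\ (mdeg y < K)%N.
  move=> /mnm_lepP lex /mnm_lepP ley; rewrite /K !ltnS !mdegE.
  by split; [apply: leq_trans (leq_addr _ _) | apply: leq_trans (leq_addl _ _)];
    apply: leq_sum => i _.
pose P (x : 'X_{1..N < K} * 'X_{1..N < K}) :=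
  [&& (x.1 <= u)%MM, (x.2 <= v)%MM, x.1 != x.2 :> 'X_{1..N},
      mnm_deg x.1 == mnm_deg x.2 & [forall i, x.1 i + x.2 i <= 1]%N].
have [x0 Px0] : exists x, P x.
  have [c [e [le_cu le_ev neq_ce deg_ce sqf]]] := uniA deg_uv neq_uv.
  have [ltc lte] := bound _ _ le_cu le_ev.
  exists (BMultinom ltc, BMultinom lte); apply/and5P; split=> //=.
    exact/eqP.
  exact/forallP.
case: (arg_minnP (fun x : 'X_{1..N < K} * 'X_{1..N < K} => mdeg x.1 + mdeg x.2)%N Px0).
case=> [[c ltc] [e lte]] /and5P[/= le_cu le_ev neq_ce /eqP deg_ce /forallP sqf] min.
exists c, e; split=> //; split=> //.
have {}min c' e' : (c' <= c)%MM -> (e' <= e)%MM -> c' != e' ->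
    mnm_deg c' = mnm_deg e' -> support_sub c e c' e'.
  move=> le_c' le_e' neq' deg' i zi.
  have [ltc' lte'] := bound _ _ (lepm_trans le_c' le_cu) (lepm_trans le_e' le_ev).
  have := min (BMultinom ltc', BMultinom lte').
  rewrite /P /= (lepm_trans le_c' le_cu) (lepm_trans le_e' le_ev) neq' deg' eqxx /=.
  move/mnm_lepP: le_c' => le_c'; move/mnm_lepP: le_e' => le_e'.
  have -> : [forall j, c' j + e' j <= 1]%N.
    by apply/forallP => j; apply: leq_trans (sqf j); apply: leq_add.
  move=> /(_ isT); rewrite !mdegE -!big_split /=.
  rewrite (bigD1 i) //= [X in (_ <= X)%N -> _](bigD1 i) //= zi add0n.
  suff: (\sum_(j < N | j != i) (c' j + e' j) <= \sum_(j < N | j != i) (c j + e j))%N.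
    by move: (\sum_(j < N | _) _)%N (\sum_(j < N | _) _)%N => s t; lia.
  by apply: leq_sum => j _; apply: leq_add.
move=> u' v' neq' deg' sub i zi.
have [-> //|nzi] := eqVneq (c i + e i)%N 0%N.
have {u' v' neq' deg' sub zi} [u' [v' [neq' deg' sqf' sub zi]]] :
  exists u' v', [/\ u' != v', mnm_deg u' = mnm_deg v', squarefree_pair u' v',
    support_sub u' v' c e & (u' i + v' i)%N = 0%N].
  have [x [y [/mnm_lepP lex /mnm_lepP ley neq_xy deg_xy sqf_xy]]] := uniA deg' neq'.
  exists x, y; split=> //; last by move: (lex i) (ley i); lia.
  by move=> j /sub; move: (lex j) (ley j); lia.
(* some entry of (u', v') opposes that of (c, e), up to swapping u' and v' *)
have {u' v' neq' deg' sqf' sub zi} [u' [v' [deg' sqf' sub zi [j opp]]]] :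
  exists u' v', [/\ mnm_deg u' = mnm_deg v', squarefree_pair u' v',
    support_sub u' v' c e, (u' i + v' i)%N = 0%N &
    exists j, (0 < u' j * e j + v' j * c j)%N].
  have [j nzj] : exists j, u' j != v' j.
    apply/existsP; rewrite -negb_forall; apply: contra neq' => /forallP eq_uv.
    by apply/eqP/mnmP => j; apply/eqP.
  have opp : (0 < u' j * e j + v' j * c j \/ 0 < v' j * e j + u' j * c j)%N.
    by move: (sub j) (sqf' j) nzj; nia.
  case: opp => opp; [exists u', v' | exists v', u']; split=> //; try by exists j.
  - by move=> k; rewrite addnC.
  - by move=> k /sub; rewrite addnC.
  - by rewrite addnC.
have neq_sum : (c + u' != e + v')%MM.
  apply/eqP => /mnmP/(_ i); rewrite !mnmDE; move: (sqf i) zi nzi; lia.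
have deg_sum : mnm_deg (c + u') = mnm_deg (e + v').
  by rewrite !mnm_degD deg_ce deg'.
have [x [y [/mnm_lepP lex /mnm_lepP ley neq_xy deg_xy sqf_xy]]] :=
  uniA (mnm_deg_sub deg_sum) (subm_neq neq_sum).
have lex' : (x <= c)%MM.
  apply/mnm_lepP => k; move: (lex k) (sqf k) (sqf' k) (sub k) (sqf_xy k).
  rewrite mnmBE !mnmDE; lia.
have ley' : (y <= e)%MM.
  apply/mnm_lepP => k; move: (ley k) (sqf k) (sqf' k) (sub k) (sqf_xy k).
  rewrite mnmBE !mnmDE; lia.
have := min x y lex' ley' neq_xy deg_xy j.
move: (lex j) (ley j) (sqf j) (sqf' j) (sqf_xy j) opp.
by rewrite !mnmBE !mnmDE; nia.
Qed.

(** By minimality of the support, the lattice vectors supported on an elementary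
    pair form a line: subtracting the multiple that cancels one entry leaves
    nothing. *)
Lemma elementary_pair_multiple c e u v : elementary_pair c e ->
  u != v -> mnm_deg u = mnm_deg v -> (forall i, u i = 0 \/ v i = 0)%N ->
  support_sub u v c e ->
  exists k, (u = c *+ k /\ v = e *+ k)%MM \/ (u = e *+ k /\ v = c *+ k)%MM.
Proof.
case=> neq_ce deg_ce sqf min neq deg_eq cop sub.
have {}min u' v' := min u' v'.
have aligned u' v' : mnm_deg u' = mnm_deg v' -> (forall i, u' i = 0 \/ v' i = 0)%N ->
    support_sub u' v' c e -> support_sub c e u' v' ->
    (exists i, 0 < u' i * c i + v' i * e i)%N ->
    exists k, (u' = c *+ k /\ v' = e *+ k)%MM.
  move=> deg' cop' sub' sup' [i al]; exists (u' i + v' i)%N; set k := (_ + _)%N.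
  (* subtracting k copies of (c, e) cancels the entry i *)
  have deg_k : mnm_deg (u' + e *+ k) = mnm_deg (v' + c *+ k).
    by rewrite !mnm_degD (mnm_deg_muln k deg_ce) deg'.
  have [eq_k|neq_k] := eqVneq (u' + e *+ k)%MM (v' + c *+ k)%MM.
    split; apply/mnmP => j; rewrite mulmnE; move/mnmP: eq_k => /(_ j);
      rewrite !mnmDE !mulmnE; move: (cop' j) (sub' j) (sup' j) (sqf j);
      by case: (c j) (e j) => [|[|a]] [|[|b]] //; lia.
  have sub_k : support_sub (u' + e *+ k - (v' + c *+ k)) (v' + c *+ k - (u' + e *+ k)) c e.
    move=> j; move: (sub' j); rewrite !mnmBE !mnmDE !mulmnE.
    by case: (c j) (e j) => [|a] [|b]; lia.
  have := min _ _ (subm_neq neq_k) (mnm_deg_sub deg_k) sub_k i.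
  move: al (cop' i) (sqf i); rewrite !mnmBE !mnmDE !mulmnE /k.
  by case: (c i) (e i) => [|[|a]] [|[|b]] //; lia.
have sup := min _ _ neq deg_eq sub.
have [i nzi] : exists i, c i != e i.
  apply/existsP; rewrite -negb_forall; apply: contra neq_ce => /forallP eq_ce.
  by apply/eqP/mnmP => j; apply/eqP.
have al : (0 < u i * c i + v i * e i \/ 0 < v i * c i + u i * e i)%N.
  by move: (sup i) (sqf i) nzi; nia.
case: al => al.
  by have [|k ?] := aligned u v deg_eq cop sub sup; [exists i | exists k; left].
have [|||k [-> ->]] := aligned v u (esym deg_eq) _ _ _ (ex_intro _ i al).
- by move=> j; case: (cop j); auto.
- by move=> j /sub; rewrite addnC.
- by move=> j; rewrite addnC => /sup.
by exists k; right.
Qed.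
End Configuration.

(** * Standard monomials of a term order *)

Section StandardMonomials.
Variables (N d : nat) (A : 'I_N -> 'rV[int]_d).
Hypotheses (homA : homogeneous_config A) (uniA : unimodular_config A).
Variables (le : rel 'X_{1..N}) (le_order : term_order le).
Implicit Types u v w c e : 'X_{1..N}.

Lemma term_order_divides u v : (u <= v)%MM -> le u v.
Proof.
move=> /submK <-; rewrite addmC -{1}[u]addm0.
exact/(term_order_add le_order)/(term_order_min le_order).
Qed.

Lemma term_order_eq u v : le u v -> le v u -> u = v.
Proof. by move=> uv vu; apply: (term_order_anti le_order); rewrite uv vu. Qed.

(** A monomial is reducible when it is not the smallest of its fibre. These will
    be the monomials of the initial ideal of the toric ideal. Homogeneity makes the
    fibres finite, whence the bounded quantifier. *)
Definition reducible u := [exists v : 'X_{1..N < (mdeg u).+1},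
  [&& mnm_deg A v == mnm_deg A u, v != u :> 'X_{1..N} & le v u]].

Lemma reducibleP u :
  reflect (exists v, [/\ mnm_deg A v = mnm_deg A u, v != u & le v u]) (reducible u).
Proof.
apply: (iffP existsP) => [[v /and3P[/eqP]]|[v [deg_v neq levu]]]; first by exists v.
have ltv : (mdeg v < (mdeg u).+1)%N by rewrite (homA deg_v).
by exists (BMultinom ltv); rewrite /= deg_v eqxx neq.
Qed.

Lemma reducible_multiple u v : (u <= v)%MM -> reducible u -> reducible v.
Proof.
move=> /submK <- /reducibleP[w [deg_w neq le_wu]]; apply/reducibleP.
exists (v - u + w)%MM; split; first by rewrite !mnm_degD deg_w.
  by rewrite eqm_add2l.
exact: (term_order_add le_order).
Qed.

Lemma standard_representative u :
  exists v, [/\ mnm_deg A v = mnm_deg A u, le v u & ~~ reducible v].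
Proof.
pose P (v : 'X_{1..N < (mdeg u).+1}) := mnm_deg A v == mnm_deg A u.
pose u0 : 'X_{1..N < (mdeg u).+1} := BMultinom (ltnSn (mdeg u)).
have Pu0 : P u0 by rewrite /P.
have [v /eqP deg_v min] :=
  extremumP (fun v : 'X_{1..N < (mdeg u).+1} => v : 'X_{1..N})
    (term_order_refl le_order) (term_order_trans le_order)
    (term_order_total le_order) Pu0.
exists v; split=> //; first exact: (min u0).
apply/negP => /reducibleP[w [deg_w neq le_wv]].
have ltw : (mdeg w < (mdeg u).+1)%N by rewrite ltnS (homA (etrans deg_w deg_v)).
have := min (BMultinom ltw); rewrite /P /= deg_w deg_v eqxx => /(_ isT) le_vw.
by rewrite (term_order_eq le_wv le_vw) eqxx in neq.
Qed.

Lemma standard_unique u v : mnm_deg A u = mnm_deg A v ->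
  ~~ reducible u -> ~~ reducible v -> u = v.
Proof.
wlog le_uv : u v / le u v.
  case/orP: (term_order_total le_order u v) => [le_uv|le_vu] wlg deg_uv ru rv.
    exact: wlg.
  by apply/esym/wlg.
move=> deg_uv _; apply: contraNeq => neq.
by apply/reducibleP; exists u.
Qed.

Lemma elementary_pair_reducible c e : elementary_pair A c e -> le e c -> reducible c.
Proof. by move=> [neq deg_ce _ _] le_ec; apply/reducibleP; exists e; rewrite eq_sym. Qed.

(** Compare u with the smallest monomial v of its fibre. An elementary pair (c, e)
    below (u, v) must decrease from c to e, since otherwise v could be reduced. *)
Lemma reducible_elementary u : reducible u ->
  exists c e, [/\ elementary_pair A c e, (c <= u)%MM & le e c].
Proof.
move=> red_u; have [v [deg_v le_vu std_v]] := standard_representative u.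
have neq : u != v by apply: contraNneq std_v => <-.
have [c [e [elem le_cu le_ev]]] := elementary_pair_exists uniA (esym deg_v) neq.
exists c, e; split=> //; case/orP: (term_order_total le_order e c) => // le_ce.
case/negP: std_v; apply: reducible_multiple le_ev _.
exact: elementary_pair_reducible (elementary_pairC elem) le_ce.
Qed.

Definition minimal_reducible u := reducible u &&
  [forall v : 'X_{1..N < (mdeg u).+1}, reducible v && (v <= u)%MM ==> (v == u :> 'X_{1..N})].

Lemma minimal_reducibleP u :
  reflect (reducible u /\ forall v, reducible v -> (v <= u)%MM -> v = u)
          (minimal_reducible u).
Proof.
apply: (iffP andP) => [[red_u /forallP min]|[red_u min]]; split=> //.
  move=> v red_v le_vu.
  have ltv : (mdeg v < (mdeg u).+1)%N.
    by rewrite ltnS !mdegE; apply: leq_sum => i _; apply/mnm_lepP.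
  by have := min (BMultinom ltv); rewrite red_v le_vu => /eqP.
by apply/forallP => v; apply/implyP => /andP[rv lev]; rewrite (min v).
Qed.

Lemma minimal_reducible_exists u : reducible u ->
  exists2 v, minimal_reducible v & (v <= u)%MM.
Proof.
have [k] := ubnP (mdeg u); elim: k u => // k IH u leu red_u.
have [min|] := boolP (minimal_reducible u); first by exists u; rewrite ?lepm_refl.
rewrite negb_and red_u => /forallPn[v]; rewrite negb_imply -andbA.
case/and3P; move: (bmnm v) => {}v red_v le_vu neq.
have [|//|w minw le_wv] := IH v; last by exists w => //; apply: lepm_trans le_vu.
rewrite ltnS in leu; apply: leq_trans leu; rewrite -(submK le_vu) mdegD -[X in (X < _)%N]add0n.
rewrite ltn_add2r lt0n mdeg_eq0.
by apply: contra neq => /eqP uv; rewrite -(submK le_vu) uv add0m.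
Qed.

(** The pairs (u, v) of this shape are the exponents of the elements of the
    reduced Groebner basis. An elementary pair (c, e) below (u, v) has c = u by
    minimality of u, and then e is a standard monomial of the fibre of v. *)
Lemma minimal_standard_elementary u v : minimal_reducible u -> ~~ reducible v ->
  mnm_deg A u = mnm_deg A v -> elementary_pair A u v.
Proof.
move=> /minimal_reducibleP[red_u min] std_v deg_uv.
have neq : u != v by apply: contraNneq std_v => <-.
have [c [e [elem le_cu le_ev]]] := elementary_pair_exists uniA deg_uv neq.
have std_e : ~~ reducible e by apply: contra std_v; apply: reducible_multiple.
have le_ec : le e c.
  case/orP: (term_order_total le_order e c) => // le_ce.
  by rewrite (elementary_pair_reducible (elementary_pairC elem)) in std_e.
have cu : c = u by apply: min le_cu; apply: elementary_pair_reducible le_ec.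
case: (elem) => _ deg_ce _ _.
by rewrite -(@standard_unique e v) -?cu // -deg_ce cu.
Qed.

End StandardMonomials.

(** * Elimination orders *)

Section EliminationOrder.
Variables (N : nat) (S : {set 'I_N}).
Implicit Types u v w : 'X_{1..N}.

Definition outer_degree u := (\sum_(i in ~: S) u i)%N.

Definition elim_le : rel 'X_{1..N} := fun u v =>
  (outer_degree u < outer_degree v)%N
  || (outer_degree u == outer_degree v) && (u <= v)%O.

Lemma elim_le_outer u v : elim_le u v -> (outer_degree u <= outer_degree v)%N.
Proof. by case/orP => [/ltnW//|/andP[/eqP->]]. Qed.

Lemma elim_le_term_order : term_order elim_le.
Proof.
have degD u v : outer_degree (u + v)%MM = (outer_degree u + outer_degree v)%N.
  by rewrite -big_split; apply: eq_bigr => i _; rewrite mnmDE.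
split.
- by move=> u; rewrite /elim_le eqxx lexx orbT.
- move=> u v /andP[uv vu].
  have /eqP deg_uv : outer_degree u == outer_degree v.
    by rewrite eqn_leq !elim_le_outer.
  by move: uv vu; rewrite /elim_le deg_uv ltnn eqxx => /= uv vu; apply/le_anti/andP.
- move=> v u w; rewrite /elim_le; case: (ltngtP (outer_degree u)) => //= [|->].
    case: (ltngtP (outer_degree v)) => //= [lt1 lt2 _ _|<- -> //].
    by rewrite (ltn_trans lt2).
  by move=> uv; case: ltngtP => //= _; apply: le_trans.
- move=> u v; rewrite /elim_le.
  by case: (ltngtP (outer_degree u)) => //= _; apply: le_total.
- move=> u; rewrite /elim_le le0m andbT orbC -leq_eqVlt.
  by rewrite /outer_degree big1 // => i _; rewrite mnm0E.
move=> w u v; rewrite /elim_le !degD ltn_add2l eqn_add2l.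
by rewrite ![(w + _)%MM]addmC lemc_add2l.
Qed.

Lemma outer_degree_eq0P u : reflect (forall i, i \notin S -> u i = 0%N) (outer_degree u == 0%N).
Proof.
rewrite sum_nat_eq0; apply: (iffP forall_inP) => H i Hi.
  by apply/eqP/H; rewrite inE.
by apply/eqP/H; rewrite inE in Hi.
Qed.

End EliminationOrder.

Section EliminationStandard.
Variables (N d : nat) (A : 'I_N -> 'rV[int]_d).
Hypotheses (homA : homogeneous_config A) (uniA : unimodular_config A).
Implicit Types u v w c e : 'X_{1..N}.

(** With respect to an order that eliminates the variables outside the support of
    (c, e), a reduction of a monomial on that support stays on that support, so it
    uses the pair (c, e) itself. *)
Lemma elementary_pair_elimination (S : {set 'I_N}) c e :
  (forall i, (i \in S) = (0 < c i + e i)%N) -> elementary_pair A c e ->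
  elim_le S e c ->
  minimal_reducible A (elim_le S) c /\ ~~ reducible A (elim_le S) e.
Proof.
move=> inS elem le_ec; have le_order := elim_le_term_order S.
have [neq deg_ce sqf _] := elem.
have not_le : ~~ (c <= e)%MM.
  apply: contra neq => /mnm_lepP le_ce; have /eqP := homA deg_ce.
  have -> : c = 0%MM.
    by apply/mnmP => i; rewrite mnm0E; move: (le_ce i) (sqf i); lia.
  by rewrite mdeg0 eq_sym mdeg_eq0 => /eqP->.
(* below the support of (c, e), only (c, e) itself can be oriented *)
have only u : (forall i, i \notin S -> u i = 0%N) -> reducible A (elim_le S) u -> (c <= u)%MM.
  move=> suppu /(reducible_elementary homA uniA le_order).
  case=> c' [e' [[neq' deg' sqf' _] /mnm_lepP le_c'u le_e'c']].
  have outc' : outer_degree S c' = 0%N.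
    apply/eqP/outer_degree_eq0P => i /suppu ui0.
    by move: (le_c'u i); rewrite ui0 leqn0 => /eqP.
  have oute' : outer_degree S e' = 0%N.
    by apply/eqP; rewrite -leqn0 -outc' elim_le_outer.
  have {outc'} c'0 := elimT (outer_degree_eq0P _ _) (introT eqP outc').
  have {oute'} e'0 := elimT (outer_degree_eq0P _ _) (introT eqP oute').
  have [||k eq_k] := elementary_pair_multiple elem neq' deg'.
  - by move=> i; move: (sqf' i); lia.
  - move=> i ci0; rewrite c'0 ?e'0 //; rewrite inS; lia.
  have k1 : k = 1%N.
    have [i nzi] : exists i, c' i != e' i.
      apply/existsP; rewrite -negb_forall; apply: contra neq' => /forallP eq_ce.
      by apply/eqP/mnmP => j; apply/eqP.
    move: nzi (sqf' i) (sqf i); case: eq_k => -[-> ->]; rewrite !mulmnE;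
      by case: (c i) (e i) => [|[|a]] [|[|b]] //; lia.
  rewrite k1 !mulm1n in eq_k; case: eq_k => -[ec ee]; first by rewrite -ec; apply/mnm_lepP.
  case/eqP: neq; apply: (term_order_eq le_order) => //.
  by rewrite -ec -ee.
split.
  apply/(minimal_reducibleP _ _ _); split.
    exact: elementary_pair_reducible elem le_ec.
  move=> v red_v le_vc; apply/mnmP => i; apply/eqP; rewrite eqn_leq.
  have /mnm_lepP -> // : (c <= v)%MM.
    apply: only => // j; rewrite inS => cj; move/mnm_lepP: le_vc => /(_ j); lia.
  by rewrite andbT; apply/mnm_lepP.
apply: contra not_le; apply: only => j; rewrite inS; lia.
Qed.
End EliminationStandard.

(** * Toric ideals *)

Section ToricIdeal.
Variables (K : fieldType) (N d : nat) (A : 'I_N -> 'rV[int]_d).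
Implicit Types (u v m : 'X_{1..N}) (a b : 'rV[int]_d) (p q : {mpoly K[N]}).

Lemma laurent_monomialD a b :
  laurent_monomial K (a + b) = laurent_monomial K a * laurent_monomial K b.
Proof.
rewrite -big_split; apply: eq_bigr => i _; rewrite mxE expfzDr //.
by rewrite tofrac_eq0 -msupp_eq0 msuppX.
Qed.

Lemma laurent_monomial0 : laurent_monomial K (0 : 'rV[int]_d) = 1.
Proof. by rewrite /laurent_monomial big1 // => i _; rewrite mxE expr0z. Qed.

Lemma laurent_monomial_nat a : (forall i, 0 <= a 0 i) ->
  laurent_monomial K a = tofrac 'X_[[multinom absz (a 0%R i) | i < d]].
Proof.
move=> a_ge0; rewrite mpolyXE_id rmorph_prod; apply: eq_bigr => i _.
by rewrite mnmE rmorphXn exprnP; congr (_ ^ _); rewrite gez0_abs.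
Qed.

Lemma mmap1_laurent u :
  mmap1 (fun i => laurent_monomial K (A i)) u = laurent_monomial K (mnm_deg A u).
Proof.
rewrite /mmap1 /mnm_deg; elim/big_rec2: _ => [|i x y _ ->].
  by rewrite laurent_monomial0.
rewrite laurent_monomialD; congr (_ * _); elim: (u i) => [|k IH].
  by rewrite mulr0n laurent_monomial0 expr0.
by rewrite exprS mulrS laurent_monomialD IH.
Qed.

HB.instance Definition _ := GRing.RMorphism.copy (@laurent_const K d)
  (@tofrac {mpoly K[d]} \o @mpolyC d K).

Lemma toric_ideal0 : toric_ideal A (0 : {mpoly K[N]}).
Proof. by rewrite /toric_ideal rmorph0. Qed.

Lemma toric_idealB p q : toric_ideal A p -> toric_ideal A q -> toric_ideal A (p - q).
Proof. by rewrite /toric_ideal rmorphB /= => -> ->; rewrite subr0. Qed.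

Lemma toric_idealM p q : toric_ideal A q -> toric_ideal A (p * q).
Proof. by rewrite /toric_ideal rmorphM /= => ->; rewrite mulr0. Qed.

Lemma toric_binomial u v : mnm_deg A u = mnm_deg A v ->
  toric_ideal A ('X_[u] - 'X_[v] : {mpoly K[N]}).
Proof. by move=> uv; rewrite /toric_ideal rmorphB /= !mmapX !mmap1_laurent uv subrr. Qed.

(** The images of the monomials of p can only cancel within a fibre. A Laurent
    monomial b clearing all denominators turns the relation into one between
    ordinary monomials, where coefficients can be compared. *)
Lemma toric_ideal_partner p u : toric_ideal A p -> u \in msupp p ->
  exists v, [/\ v \in msupp p, v != u & mnm_deg A v = mnm_deg A u].
Proof.
move=> toric_p p_u.
suff: has (fun v => (v != u) && (mnm_deg A v == mnm_deg A u)) (msupp p).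
  by case/hasP => v p_v /andP[neq /eqP deg_v]; exists v.
apply: contraLR p_u => /hasPn alone; rewrite -mcoeff_eq0.
pose b : 'rV[int]_d := \row_i \sum_(v <- msupp p) `|mnm_deg A v 0 i|.
have b_ge v : v \in msupp p -> forall i, 0 <= (b + mnm_deg A v) 0 i.
  move=> p_v i; rewrite !mxE -lerBlDr sub0r (big_rem v) //= -[leLHS]addr0.
  by rewrite lerD ?sumr_ge0 // -normrN ler_norm.
pose X v : 'X_{1..d} := [multinom absz ((b + mnm_deg A v)%R 0%R i) | i < d].
have: tofrac (\sum_(v <- msupp p) p@_v *: 'X_[X v]) = 0 :> {fraction {mpoly K[d]}}.
  transitivity (laurent_monomial K b *
    mmap (@laurent_const K d) (fun i => laurent_monomial K (A i)) p); last first.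
    by rewrite toric_p mulr0.
  rewrite rmorph_sum /mmap mulr_sumr big_seq [RHS]big_seq; apply: eq_bigr => v p_v.
  rewrite mmap1_laurent mulrCA -laurent_monomialD laurent_monomial_nat; last exact: b_ge.
  by rewrite -mul_mpolyC rmorphM.
move/eqP; rewrite tofrac_eq0 => /eqP/(congr1 (mcoeff (X u))).
rewrite mcoeff0 raddf_sum /=.
have [p_u|] := boolP (u \in msupp p); last by move=> /memN_msupp_eq0 ->.
rewrite (bigD1_seq u) ?msupp_uniq //= mcoeffZ mcoeffX eqxx mulr1.
rewrite big_seq_cond big1 ?addr0 => [->//|v /andP[p_v neq]].
rewrite mcoeffZ mcoeffX; case: eqP => [eqX|]; last by rewrite mulr0.
case/negP: (alone v p_v); rewrite neq; apply/eqP/rowP => i.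
have := congr1 (fun m : 'X_{1..d} => m i) eqX; rewrite /= !mnmE.
move/(congr1 Posz); rewrite !gez0_abs ?b_ge //.
by rewrite mxE [RHS]mxE => /addrI.
Qed.

End ToricIdeal.

(** * Binomials and monomial ideals *)

Section Binomials.
Variables (K : fieldType) (N : nat).
Implicit Types (u v m : 'X_{1..N}) (p q : {mpoly K[N]}).

Lemma mcoeff_binomial u v m :
  ('X_[u] - 'X_[v] : {mpoly K[N]})@_m = (u == m)%:R - (v == m)%:R.
Proof. by rewrite mcoeffB !mcoeffX. Qed.

Lemma msupp_binomial u v m : u != v ->
  (m \in msupp ('X_[u] - 'X_[v] : {mpoly K[N]})) = (m == u) || (m == v).
Proof.
move=> neq; rewrite mcoeff_msupp mcoeff_binomial ![_ == m]eq_sym.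
have [-> | _] := eqVneq m u; first by rewrite (negPf neq) subr0 oner_neq0.
by case: (m == v); rewrite sub0r oppr_eq0 ?oner_eq0 ?eqxx.
Qed.

Lemma binomial_eq0 u v : ('X_[u] - 'X_[v] == 0 :> {mpoly K[N]}) = (u == v).
Proof.
have [->|neq] := eqVneq u v; first by rewrite subrr eqxx.
apply/negP => /eqP p0; have := msupp_binomial u neq.
by rewrite p0 msupp0 eqxx.
Qed.

Lemma monomial_ideal_divides (M : 'X_{1..N} -> Prop) m :
  monomial_ideal M ('X_[m] : {mpoly K[N]}) -> exists2 m', M m' & (m' <= m)%MM.
Proof.
case=> s Ms Xm.
have [[/= q r] s_c /= c_m] : exists2 c, c \in s & m \in msupp (c.1 * c.2).
  apply/hasP; have: m \in msupp ('X_[m] : {mpoly K[N]}) by rewrite msuppX inE.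
  apply: contraLR => /hasPn none; rewrite Xm -mcoeff_eq0 raddf_sum /=.
  by rewrite big_seq big1 // => c /none; rewrite -mcoeff_eq0 => /eqP.
have [m' Mm' r_m'] := Ms _ s_c; exists m' => //.
rewrite /= in r_m'; rewrite r_m' in c_m.
have /allpairsP[[a b] [_ /=]] := msuppM_le c_m.
by rewrite msuppX inE => /eqP-> ->; apply: lem_addl.
Qed.

Lemma monomial_ideal_refine (M M' : 'X_{1..N} -> Prop) p :
  (forall m, M m -> exists2 m', M' m' & (m' <= m)%MM) ->
  monomial_ideal M p -> monomial_ideal M' p.
Proof.
move=> MM' [s Ms ->]; elim: s Ms => [|[q r] s IH] Ms.
  by exists [::]; rewrite ?big_nil.
have [|s' Ms' eqs] := IH; first by move=> c s_c; apply: Ms; rewrite inE s_c orbT.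
have [m Mm /= ->] := Ms (q, r) (mem_head _ _).
have [m' Mm' /submK <-] := MM' m Mm.
exists ((q * 'X_[m - m'], 'X_[m']) :: s').
  by move=> c; rewrite inE => /predU1P[->|/Ms' //]; exists m'.
by rewrite !big_cons eqs /= mpolyXD mulrA.
Qed.

End Binomials.

(** * Leading monomials *)

Section LeadingMonomials.
Variables (K : fieldType) (N : nat) (le : rel 'X_{1..N}).
Hypothesis le_order : term_order le.
Implicit Types (u v m : 'X_{1..N}) (p q : {mpoly K[N]}).

Lemma leading_monomial_exists p : p != 0 -> exists m, leading_monomial le p m.
Proof.
rewrite -msupp_eq0 /leading_monomial.
elim: (msupp p) => // a [_ _|b s /(_ isT)[m [s_m max]] _].
  exists a; rewrite inE; split=> // m; rewrite inE => /eqP->.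
  exact: (term_order_refl le_order).
have trans := term_order_trans le_order.
case/orP: (term_order_total le_order a m) => [le_am|le_ma].
  exists m; rewrite inE s_m orbT; split=> // m'.
  by rewrite inE => /predU1P[->|/max].
exists a; rewrite mem_head; split=> // m'.
rewrite inE => /predU1P[->|/max le_m]; first exact: (term_order_refl le_order).
exact: trans le_ma.
Qed.

Lemma leading_monomial_unique p m m' :
  leading_monomial le p m -> leading_monomial le p m' -> m = m'.
Proof. by move=> [pm maxm] [pm' maxm']; apply: (term_order_eq le_order); auto. Qed.

Lemma leading_monomial_binomial u v : u != v -> le v u ->
  leading_monomial le ('X_[u] - 'X_[v] : {mpoly K[N]}) u.
Proof.
move=> neq le_vu; split; first by rewrite msupp_binomial // eqxx.
move=> m; rewrite msupp_binomial // => /orP[]/eqP-> //.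
exact: (term_order_refl le_order).
Qed.

End LeadingMonomials.

(** * Groebner bases of unimodular toric ideals *)

Section ToricGroebner.
Variables (K : fieldType) (N d : nat) (A : 'I_N -> 'rV[int]_d).
Hypotheses (homA : homogeneous_config A) (uniA : unimodular_config A).
Variable I : {mpoly K[N]} -> Prop.
Hypothesis toricI : forall p, I p <-> toric_ideal A p.
Variable le : rel 'X_{1..N}.
Hypothesis le_order : term_order le.
Implicit Types (u v m : 'X_{1..N}) (p q : {mpoly K[N]}).

Local Notation reducible := (reducible A le).
Local Notation minimal_reducible := (minimal_reducible A le).

Lemma leading_monomial_reducible p m : I p -> leading_monomial le p m -> reducible m.
Proof.
move=> /toricI Ip [p_m max]; apply/(reducibleP homA).
have [v [p_v neq deg_v]] := toric_ideal_partner Ip p_m.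
by exists v; split=> //; apply: max.
Qed.

Lemma reducible_leading_monomial u v : mnm_deg A u = mnm_deg A v -> reducible u ->
  ~~ reducible v ->
  I ('X_[u] - 'X_[v]) /\ leading_monomial le ('X_[u] - 'X_[v] : {mpoly K[N]}) u.
Proof.
move=> deg_uv red_u std_v; split; first by apply/toricI/toric_binomial.
have neq : u != v by apply: contraNneq std_v => <-.
apply: leading_monomial_binomial => //.
case/orP: (term_order_total le_order v u) => // le_uv.
by case/negP: std_v; apply/(reducibleP homA); exists u.
Qed.

Lemma initial_idealP p : initial_ideal le I p <-> monomial_ideal (fun m => reducible m) p.
Proof.
split; apply: monomial_ideal_refine => m.
  by case=> q Iq lead; exists m; rewrite ?lepm_refl ?(leading_monomial_reducible Iq).
move=> red_m; have [v [deg_v le_vm std_v]] := standard_representative homA le_order m.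
exists m; rewrite ?lepm_refl //.
have [Ib lead] := reducible_leading_monomial (esym deg_v) red_m std_v.
by exists ('X_[m] - 'X_[v]).
Qed.

Lemma initial_ideal_squarefree :
  generated_by_squarefree_monomials (initial_ideal le I).
Proof.
exists (fun c => exists2 e, elementary_pair A c e & le e c).
  by move=> c [e [_ _ sqf _] _] i; apply: leq_trans (sqf i); apply: leq_addr.
move=> p; rewrite initial_idealP; split; apply: monomial_ideal_refine => m.
  move=> /(reducible_elementary homA uniA le_order)[c [e [elem le_cm le_ec]]].
  by exists c => //; exists e.
case=> e elem le_ec; exists m; rewrite ?lepm_refl //.
exact: (elementary_pair_reducible homA elem).
Qed.

(** Let u be the leading monomial of p. By reducedness u is minimal among the
    leading monomials of the ideal and the other monomials of p are standard. One
    of them, v, shares the fibre of u; subtracting the binomial of (u, v) from p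
    leaves an element of the ideal with standard monomials only, hence 0. *)
Lemma reduced_groebner_element (B : seq {mpoly K[N]}) p :
  reduced_groebner_basis le I B -> p \in B ->
  exists u v, [/\ p = 'X_[u] - 'X_[v], minimal_reducible u, ~~ reducible v
    & mnm_deg A u = mnm_deg A v].
Proof.
case=> [[B_I B_neq0 B_init] B_monic B_ndiv] B_p.
have divides m : reducible m ->
    exists g m', [/\ g \in B, leading_monomial le g m' & (m' <= m)%MM].
  move=> red_m.
  have /B_init/monomial_ideal_divides[m' [g B_g lead] le_m'm] :
      initial_ideal le I ('X_[m] : {mpoly K[N]}).
    apply/initial_idealP; exists [:: (1, 'X_[m])]; last by rewrite big_seq1 mul1r.
    by move=> c; rewrite inE => /eqP->; exists m.
  by exists g, m'.
have [u lead_u] := leading_monomial_exists le_order (B_neq0 p B_p).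
have [p_u max_u] := lead_u.
have red_u := leading_monomial_reducible (B_I p B_p) lead_u.
have std m : m \in msupp p -> m != u -> ~~ reducible m.
  move=> p_m; apply: contra => /divides[g [m' [B_g lead le_m'm]]].
  have [eq_pg|neq_pg] := eqVneq p g; last first.
    by have := B_ndiv p g m' m B_p B_g neq_pg lead p_m; rewrite le_m'm.
  rewrite -eq_pg in lead; rewrite -(leading_monomial_unique le_order lead lead_u) in max_u *.
  by apply/eqP/(term_order_eq le_order); [apply: max_u | apply: term_order_divides].
have [v [p_v neq deg_v]] := toric_ideal_partner (proj1 (toricI p) (B_I p B_p)) p_u.
exists u, v; split=> //; last exact: std.
- apply/eqP; rewrite -subr_eq0; apply/negPn/negP => nz.
  have Iq : I (p - ('X_[u] - 'X_[v])).
    apply/toricI/toric_idealB; first exact/toricI/B_I.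
    exact: toric_binomial.
  have [m lead_m] := leading_monomial_exists le_order nz.
  have red_m := leading_monomial_reducible Iq lead_m.
  have [q_m _] := lead_m.
  have neq_mu : m != u.
    apply: contraTneq q_m => ->; rewrite -mcoeff_eq0 mcoeffB (B_monic p u) //.
    by rewrite mcoeff_binomial eqxx (negPf neq) subr0 subrr.
  suff p_m : m \in msupp p by have := std m p_m neq_mu; rewrite red_m.
  apply: contraTT q_m; rewrite -!mcoeff_eq0 mcoeffB mcoeff_binomial => /eqP pm0.
  have /negPf -> : v != m.
    by apply: contraTneq p_v => ->; rewrite -mcoeff_eq0 pm0.
  by rewrite pm0 [u == m]eq_sym (negPf neq_mu) !subr0.
apply/(minimal_reducibleP _ _ _); split=> // w red_w le_wu.
have [g [m' [B_g lead le_m'w]]] := divides w red_w.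
have [eq_pg|neq_pg] := eqVneq p g; last first.
  have := B_ndiv p g m' u B_p B_g neq_pg lead p_u.
  by rewrite (lepm_trans le_m'w).
rewrite -eq_pg in lead; rewrite (leading_monomial_unique le_order lead lead_u) in le_m'w.
by apply: (term_order_eq le_order); apply: term_order_divides.
Qed.

Lemma elementary_mdeg u v : elementary_pair A u v -> (mdeg u < N.+1)%N /\ (mdeg v < N.+1)%N.
Proof.
case=> _ /homA deg_uv sqf _; rewrite -deg_uv ltnS; split=> //;
  rewrite mdegE -[leqRHS]card_ord -sum1_card; apply: leq_sum => i _;
  exact: leq_trans (leq_addr _ _) (sqf i).
Qed.

(** The binomials in question have squarefree terms, of degree at most N, so they
    form a finite list. *)
Lemma reduced_groebner_exists : exists B : seq {mpoly K[N]},
  reduced_groebner_basis le I B /\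
  forall u v, minimal_reducible u -> ~~ reducible v -> mnm_deg A u = mnm_deg A v ->
    'X_[u] - 'X_[v] \in B.
Proof.
pose P (x : 'X_{1..N < N.+1} * 'X_{1..N < N.+1}) :=
  [&& minimal_reducible x.1, ~~ reducible x.2 & mnm_deg A x.1 == mnm_deg A x.2].
exists [seq 'X_[x.1] - 'X_[x.2] | x : 'X_{1..N < N.+1} * 'X_{1..N < N.+1} <- enum P].
set B := map _ _.
have B_P p : p \in B -> exists u v, [/\ p = 'X_[u] - 'X_[v], minimal_reducible u,
    ~~ reducible v & mnm_deg A u = mnm_deg A v].
  case/mapP => [[u v]]; rewrite mem_enum => /and3P[/= min_u std_v /eqP deg_uv] ->.
  by exists (u : 'X_{1..N}), (v : 'X_{1..N}).
have P_B u v : minimal_reducible u -> ~~ reducible v -> mnm_deg A u = mnm_deg A v ->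
    'X_[u] - 'X_[v] \in B.
  move=> min_u std_v deg_uv.
  have [ltu ltv] := elementary_mdeg
    (minimal_standard_elementary homA uniA le_order min_u std_v deg_uv).
  apply/mapP; exists (BMultinom ltu, BMultinom ltv) => //=.
  by rewrite mem_enum; apply/and3P; split=> //; apply/eqP.
have lead_B p u v : p = 'X_[u] - 'X_[v] -> minimal_reducible u -> ~~ reducible v ->
    mnm_deg A u = mnm_deg A v -> [/\ I p, u != v & leading_monomial le p u].
  move=> -> /andP[red_u _] std_v deg_uv.
  have [Ip lead] := reducible_leading_monomial deg_uv red_u std_v; split=> //.
  by apply: contraNneq std_v => <-.
split=> //; split.
- split.
  + by move=> p /B_P[u [v [def_p min_u std_v deg_uv]]]; case: (lead_B p u v).
  + move=> p /B_P[u [v [def_p min_u std_v deg_uv]]].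
    by case: (lead_B p u v) => //; rewrite def_p binomial_eq0.
  + move=> p; rewrite initial_idealP; split; apply: monomial_ideal_refine => m.
      move=> /minimal_reducible_exists[u min_u le_um]; exists u => //.
      have [v [deg_v _ std_v]] := standard_representative homA le_order u.
      exists ('X_[u] - 'X_[v]); first exact: P_B.
      by case: (lead_B _ u v erefl min_u std_v (esym deg_v)).
    case=> g /B_P[u [v [def_g min_u std_v deg_uv]]] lead; exists m; rewrite ?lepm_refl //.
    have [Ig _ _] := lead_B g u v def_g min_u std_v deg_uv.
    exact: leading_monomial_reducible lead.
- move=> p m /B_P[u [v [def_p min_u std_v deg_uv]]] lead.
  have [_ neq lead_u] := lead_B p u v def_p min_u std_v deg_uv.
  rewrite (leading_monomial_unique le_order lead lead_u) def_p mcoeff_binomial eqxx.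
  by rewrite eq_sym (negPf neq) subr0.
move=> g h m m' /B_P[u [v [def_g min_u std_v deg_uv]]].
move=> /B_P[u' [v' [def_h min_u' std_v' deg_uv']]] neq_gh lead.
have [_ neq _] := lead_B g u v def_g min_u std_v deg_uv.
have [_ _ lead_u'] := lead_B h u' v' def_h min_u' std_v' deg_uv'.
rewrite (leading_monomial_unique le_order lead lead_u') def_g msupp_binomial //.
have /(minimal_reducibleP _ _ _)[red_u' _] := min_u'.
case/orP => /eqP->; last by apply: contra std_v => /reducible_multiple; apply.
apply: contra neq_gh => le_u'u; have /(minimal_reducibleP _ _ _)[_ min] := min_u.
have eq_u := min _ red_u' le_u'u; rewrite def_g def_h eq_u.
have -> // : v = v'; apply: (standard_unique homA le_order) => //.
by rewrite -deg_uv -deg_uv' eq_u.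
Qed.

End ToricGroebner.

(** * Irreducible binomials *)

Section BinomialIrreducibility.
Variables (K : fieldType) (N : nat).
Implicit Types (u v m : 'X_{1..N}) (p q : {mpoly K[N]}).

(** The coefficient of degree k of [grade_by j p] gathers the monomials of p of
    degree k in the variable j. Being a ring morphism to polynomials over a domain,
    it makes partial degrees additive. *)
Definition grade_by (j : 'I_N) : {mpoly K[N]} -> {poly {mpoly K[N]}} :=
  mmap (@polyC {mpoly K[N]} \o @mpolyC N K)
    (fun i => if i == j then ('X_i)%:P * 'X else ('X_i)%:P).

HB.instance Definition _ j := GRing.RMorphism.on (grade_by j).

Lemma grade_byX j m : grade_by j 'X_[m] = ('X_[m])%:P * 'X^(m j).
Proof.
rewrite /grade_by mmapX /mmap1 mpolyXE_id (bigD1 j) //= eqxx.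
rewrite [in RHS](bigD1 j) //= rmorphM rmorph_prod exprMn mulrAC rmorphXn.
by congr (_ * _ * _); apply: eq_bigr => i /negPf->; rewrite rmorphXn.
Qed.

Lemma coef_grade_by j p k m :
  (grade_by j p)`_k@_m = if m j == k then p@_m else 0.
Proof.
rewrite {1}[p]mpolyE rmorph_sum coef_sum raddf_sum /=.
have E a : a \in msupp p ->
    (grade_by j (p@_a *: 'X_[a]))`_k@_m = if (m j == k) && (a == m) then p@_m else 0.
  move=> _; rewrite -mul_mpolyC rmorphM /= grade_byX /grade_by mmapC /= coefCM coefCM coefXn.
  rewrite mcoeffCM mulr_natr mcoeffMn mcoeffX.
  have [->|_] := eqVneq a m; last by rewrite mul0rn mulr0 andbF.
  by rewrite andbT eq_sym; case: eqP => _; rewrite ?mulr1n ?mulr0n ?mulr1 ?mulr0.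
rewrite big_seq (eq_bigr _ E) -big_seq.
case: ifP => [/eqP jk|jk]; last by rewrite big1.
have [p_m|] := boolP (m \in msupp p); last first.
  move=> np_m; rewrite (memN_msupp_eq0 np_m) big1 // => a _.
  by case: ifP.
rewrite (bigD1_seq m) ?msupp_uniq //= eqxx big1 ?addr0 // => a /negPf neq.
by rewrite neq.
Qed.

Lemma msuppM_partial_degree j p q a b : a \in msupp p -> b \in msupp q ->
  exists2 m, m \in msupp (p * q) & (a j + b j <= m j)%N.
Proof.
move=> p_a q_b.
have size_ge r c : c \in msupp r -> (c j < size (grade_by j r))%N.
  rewrite mcoeff_msupp; apply: contraR; rewrite -leqNgt => /leq_sizeP/(_ _ (leqnn _)).
  by move/(congr1 (mcoeff c)); rewrite coef_grade_by eqxx mcoeff0 => ->.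
have [size_p size_q] := (size_ge _ _ p_a, size_ge _ _ q_b).
have := coef_grade_by j (p * q).
have -> : grade_by j (p * q) = grade_by j p * grade_by j q by exact: rmorphM.
move: (grade_by j p) (grade_by j q) size_p size_q => P Q size_p size_q coefPQ.
have nzP : P != 0 by apply: contraTneq size_p => ->; rewrite size_poly0.
have nzQ : Q != 0 by apply: contraTneq size_q => ->; rewrite size_poly0.
have [m PQ_m] : exists m, m \in msupp (lead_coef (P * Q)).
  have : lead_coef (P * Q) != 0 by rewrite lead_coef_eq0; apply: mulf_neq0.
  rewrite -msupp_eq0; case: (msupp _) => [//|m s] _.
  by exists m; apply: mem_head.
move: PQ_m; rewrite mcoeff_msupp lead_coefE coefPQ.
case: (m j =P _) => [jm|_]; last by rewrite eqxx.
rewrite -mcoeff_msupp => pq_m; exists m => //; rewrite jm (size_mul nzP nzQ).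
move: (size P) (size Q) size_p size_q => [|k] [|l] // ltk ltl.
by rewrite addSn addnS /= leq_add.
Qed.

Lemma mpoly_nonunit p a : a \in msupp p -> a != 0%MM -> p \isn't a GRing.unit.
Proof.
move=> p_a neq; apply/negP => /andP[/eqP def_p _].
by move: p_a; rewrite def_p mcoeff_msupp mcoeffC (negPf neq) mulr0 eqxx.
Qed.

Lemma mpoly_constant_unit p : p != 0 -> (forall a, a \in msupp p -> a = 0%MM) ->
  p \is a GRing.unit.
Proof.
move=> nz const; have def_p : p = (p@_0)%:MP.
  apply/mpolyP => a; rewrite mcoeffC; have [->|neq] := eqVneq a 0%MM; first by rewrite mulr1.
  by rewrite mulr0; apply/memN_msupp_eq0/negP => /const /eqP; rewrite (negPf neq).
apply/andP; split; first exact/eqP.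
by rewrite unitfE; apply: contraNneq nz => p0; rewrite def_p p0 mpolyC0.
Qed.

(** Let the binomial be q * r. Partial degrees are at most 1 and additive, so q and
    r involve disjoint sets of variables, and every product of a monomial of q and
    one of r survives in q * r. Only two monomials are available; if q has two
    monomials, each monomial of r divides both terms of the binomial, which are
    coprime, so r is constant. *)
Lemma squarefree_binomial_irreducible u v : u != v -> squarefree_pair u v ->
  irreducible ('X_[u] - 'X_[v] : {mpoly K[N]}).
Proof.
move=> neq sqf; have supp := msupp_binomial K _ neq.
split; first by rewrite binomial_eq0.
  have [u0|nzu] := eqVneq u 0%MM; last by apply: (mpoly_nonunit _ nzu); rewrite supp eqxx.
  by apply: (@mpoly_nonunit _ v); rewrite ?supp ?eqxx ?orbT // -u0 eq_sym.
move=> q r def_p.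
have nzqr : q * r != 0 by rewrite -def_p binomial_eq0.
have nzq : q != 0 by apply: contraNneq nzqr => ->; rewrite mul0r.
have nzr : r != 0 by apply: contraNneq nzqr => ->; rewrite mulr0.
have disj a b j : a \in msupp q -> b \in msupp r -> (a j + b j <= 1)%N.
  move=> q_a r_b; have [m] := msuppM_partial_degree j q_a r_b.
  rewrite -def_p supp => /orP[]/eqP-> le_abj; apply: leq_trans le_abj _;
    by apply: leq_trans (sqf j); rewrite ?leq_addr ?leq_addl.
(* products of monomials of q and r cannot cancel *)
have sum_supp a b : a \in msupp q -> b \in msupp r -> (a + b = u \/ a + b = v)%MM.
  move=> q_a r_b; suff: (a + b)%MM \in msupp (q * r).
    by rewrite -def_p supp => /orP[]/eqP->; auto.
  rewrite mcoeff_msupp mcoeffM.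
  have lta : (mdeg a < (mdeg (a + b)).+1)%N by rewrite mdegD; lia.
  have ltb : (mdeg b < (mdeg (a + b)).+1)%N by rewrite mdegD; lia.
  rewrite (bigD1 (BMultinom lta, BMultinom ltb)) //= big1 ?addr0.
    by rewrite mulf_neq0 // -mcoeff_msupp.
  case=> [[a' lta'] [b' ltb']] /= /andP[/eqP eq_ab neq_ab].
  apply/eqP; rewrite mulf_eq0 !mcoeff_eq0 -negb_and; apply: contra neq_ab => /andP[q_a' r_b'].
  rewrite xpair_eqE.
  have eqE j := congr1 (fun m : 'X_{1..N} => m j) eq_ab.
  apply/andP; split; apply/eqP/val_inj/mnmP => j /=; move: (eqE j); rewrite /= !mnmDE;
    by move: (disj _ _ j q_a r_b) (disj _ _ j q_a' r_b) (disj _ _ j q_a r_b') (disj _ _ j q_a' r_b'); lia.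
have common b : (b <= u)%MM -> (b <= v)%MM -> b = 0%MM.
  move=> /mnm_lepP leu /mnm_lepP lev; apply/mnmP => j.
  by rewrite mnm0E; move: (leu j) (lev j) (sqf j); lia.
have split_supp m : m \in msupp (q * r) ->
    exists a b, [/\ a \in msupp q, b \in msupp r & m = (a + b)%MM].
  by case/msuppM_le/allpairsP => [[a b] /= [q_a r_b ->]]; exists a, b.
have [|a1 [b1 [q_a1 r_b1 def_u]]] := split_supp u; first by rewrite -def_p supp eqxx.
have [|a2 [b2 [q_a2 r_b2 def_v]]] := split_supp v; first by rewrite -def_p supp eqxx orbT.
have [eq_a|neq_a] := eqVneq a1 a2.
  have neq_b : b1 != b2 by apply: contraNneq neq => eq_b; rewrite def_u def_v eq_a eq_b.
  left; apply: mpoly_constant_unit => // a q_a; apply: common.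
    by case: (sum_supp a b1 q_a r_b1) (sum_supp a b2 q_a r_b2) => [<-|h1 [<-|h2]];
      rewrite ?lem_addr //; case/eqP: neq_b; apply: (@addmI _ a); rewrite h1 h2.
  by case: (sum_supp a b1 q_a r_b1) (sum_supp a b2 q_a r_b2) => [h1 [h2|<-]|<- _];
    rewrite ?lem_addr //; case/eqP: neq_b; apply: (@addmI _ a); rewrite h1 h2.
right; apply: mpoly_constant_unit => // b r_b; apply: common.
  by case: (sum_supp a1 b q_a1 r_b) (sum_supp a2 b q_a2 r_b) => [<-|h1 [<-|h2]];
    rewrite ?lem_addl //; case/eqP: neq_a; apply: (@addIm _ b); rewrite h1 h2.
by case: (sum_supp a1 b q_a1 r_b) (sum_supp a2 b q_a2 r_b) => [h1 [h2|<-]|<- _];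
  rewrite ?lem_addl //; case/eqP: neq_a; apply: (@addIm _ b); rewrite h1 h2.
Qed.

End BinomialIrreducibility.

(** * Circuits of unimodular toric ideals *)

Section ToricCircuits.
Variables (K : fieldType) (N d : nat) (A : 'I_N -> 'rV[int]_d).
Hypotheses (homA : homogeneous_config A) (uniA : unimodular_config A).
Implicit Types (u v m c e : 'X_{1..N}) (p q : {mpoly K[N]}).

Lemma vars_binomial u v i : u != v ->
  (i \in vars ('X_[u] - 'X_[v] : {mpoly K[N]})) = (0 < u i + v i)%N.
Proof.
move=> neq; rewrite inE addn_gt0; apply/hasP/orP => [[m]|].
  by rewrite msupp_binomial // => /orP[]/eqP->; auto.
by case=> lt0; [exists u | exists v]; rewrite ?msupp_binomial // eqxx ?orbT.
Qed.

Lemma toric_binomial_deg u v : u != v ->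
  toric_ideal A ('X_[u] - 'X_[v] : {mpoly K[N]}) -> mnm_deg A u = mnm_deg A v.
Proof.
move=> neq toric.
have [|w [p_w neq_w <-]] := toric_ideal_partner (u := v) toric.
  by rewrite msupp_binomial // eqxx orbT.
by move: p_w; rewrite msupp_binomial // (negPf neq_w) orbF => /eqP->.
Qed.

Lemma elementary_pair_circuit c e : elementary_pair A c e ->
  circuit (toric_ideal A) ('X_[c] - 'X_[e] : {mpoly K[N]}).
Proof.
move=> [neq deg_ce sqf min]; split.
- by exists c, e.
- exact: squarefree_binomial_irreducible.
- exact: toric_binomial.
move=> _ [u [v ->]]; rewrite binomial_eq0 => neq_uv toric.
have deg_uv := toric_binomial_deg neq_uv toric.
apply/negP => /properP[/subsetP sub [i]].
have sub_uv : support_sub u v c e.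
  move=> j; have := sub j; rewrite !vars_binomial //; lia.
rewrite !vars_binomial //; have := min _ _ neq_uv deg_uv sub_uv i; lia.
Qed.

(** An irreducible binomial has coprime terms. An elementary pair below its
    exponents has the same support because the circuit has minimal support, so the
    exponents are a multiple k of the pair, and the factorization of a difference
    of k-th powers forces k = 1. *)
Lemma circuit_elementary_pair p : circuit (toric_ideal A) p ->
  exists c e, elementary_pair A c e /\ p = 'X_[c] - 'X_[e].
Proof.
case=> [[u [v ->]] [nz _ irr]]; rewrite binomial_eq0 in nz => toric min.
have deg_uv := toric_binomial_deg nz toric.
have nonconst a b : mnm_deg A a = mnm_deg A b -> a != b ->
    'X_[a] - 'X_[b] \isn't a @GRing.unit {mpoly K[N]}.
  move=> /homA deg_ab neq; apply: (@mpoly_nonunit _ _ _ a).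
    by rewrite msupp_binomial // eqxx.
  apply: contraNneq neq => a0; rewrite a0 eq_sym -mdeg_eq0 -deg_ab a0.
  by rewrite mdeg0.
have cop i : u i = 0%N \/ v i = 0%N.
  have [ui|nui] := eqVneq (u i) 0%N; first by left.
  have [vi|nvi] := eqVneq (v i) 0%N; first by right.
  have def_u : u = (U_(i) + (u - U_(i)))%MM by rewrite addmC submK // lep1mP.
  have def_v : v = (U_(i) + (v - U_(i)))%MM by rewrite addmC submK // lep1mP.
  have [||] := irr 'X_i ('X_[u - U_(i)] - 'X_[v - U_(i)]).
  - by rewrite mulrBr -!mpolyXD -def_u -def_v.
  - by rewrite (negPf (mpoly_nonunit (a := U_(i)%MM) _ _)) ?msuppX ?inE ?mnm1_eq0.
  rewrite (negPf (nonconst _ _ _ _)) //.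
    by apply: (@addrI _ (mnm_deg A U_(i))); rewrite -!mnm_degD -def_u -def_v.
  by apply: contraNneq nz => eq_uv; rewrite def_u def_v eq_uv.
have [c [e [elem le_cu le_ev]]] := elementary_pair_exists uniA deg_uv nz.
have [neq deg_ce sqf _] := elem.
have sub : support_sub u v c e.
  have := min ('X_[c] - 'X_[e]); rewrite binomial_eq0 => /(_ _ neq (toric_binomial K deg_ce)).
  rewrite properE negb_and negbK.
  move=> /(_ (ex_intro _ c (ex_intro _ e erefl))) /orP[/subsetPn[i]|/subsetP sub i].
    rewrite !vars_binomial //; move/mnm_lepP: le_cu => /(_ i); move/mnm_lepP: le_ev => /(_ i).
    lia.
  have := sub i; rewrite !vars_binomial //; lia.
have [k [[def_u def_v]|[def_u def_v]]] := elementary_pair_multiple elem nz deg_uv cop sub.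
  exists c, e; split=> //; suff k1 : k = 1%N by rewrite def_u def_v k1 !mulm1n.
  have := subrXX ('X_[c] : {mpoly K[N]}) 'X_[e] k; rewrite !mpolyXn -def_u -def_v.
  set S := \sum_(i < k) _ => def_p.
  case: (irr _ _ def_p) => [|/andP[/eqP const_S _]].
    by rewrite (negPf (nonconst _ _ _ _)).
  have: u \in msupp ('X_[u] - 'X_[v] : {mpoly K[N]}) by rewrite msupp_binomial // eqxx.
  rewrite def_p const_S mulrC mul_mpolyC => /msuppZ_le; rewrite msupp_binomial // => u_ce.
  have deg_u : mdeg u = mdeg c by case/orP: u_ce => /eqP-> //; rewrite (homA deg_ce).
  have nz_c : mdeg c != 0%N.
    rewrite mdeg_eq0; apply: contraNneq neq => c0.
    by rewrite c0 eq_sym -mdeg_eq0 -(homA deg_ce) c0 mdeg0.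
  by move: deg_u nz_c; rewrite def_u mdegMn; nia.
(* a coordinate of c would have to occur in both c and e *)
have c0 : c = 0%MM.
  apply/mnmP => i; rewrite mnm0E; move/mnm_lepP: le_cu => /(_ i).
  by rewrite def_u mulmnE; move: (sqf i); nia.
case/eqP: neq; rewrite c0; apply/esym/eqP; rewrite -mdeg_eq0 -(homA deg_ce) c0.
by rewrite mdeg0.
Qed.

End ToricCircuits.

(** * The universal Groebner basis *)

Section Universal.
Variables (K : fieldType) (N d : nat) (A : 'I_N -> 'rV[int]_d).
Hypotheses (homA : homogeneous_config A) (uniA : unimodular_config A).
Variable I : {mpoly K[N]} -> Prop.
Hypothesis toricI : forall p, I p <-> toric_ideal A p.

Lemma universal_groebner_circuit p :
  universal_groebner_basis I p -> circuit (toric_ideal A) p.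
Proof.
case=> le [B [le_order red_B B_p]].
have [u [v [-> min_u std_v deg_uv]]] := reduced_groebner_element homA toricI le_order red_B B_p.
exact/elementary_pair_circuit/(minimal_standard_elementary homA uniA le_order).
Qed.

(** One elimination order serves both orientations of the pair: whichever of c and
    e is larger becomes a leading monomial of the reduced Groebner basis. *)
Lemma circuit_universal_groebner p :
  circuit (toric_ideal A) p -> up_to_sign (universal_groebner_basis I) p.
Proof.
case/(circuit_elementary_pair homA uniA) => c [e [elem ->]].
pose S := [set i | 0 < c i + e i]%N; have le_order := elim_le_term_order S.
have [B [red_B memB]] := reduced_groebner_exists homA uniA toricI le_order.
have oriented c' e' : elementary_pair A c' e' -> (forall i, c' i + e' i = c i + e i)%N ->
    elim_le S e' c' -> universal_groebner_basis I ('X_[c'] - 'X_[e']).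
  move=> elem' supp le_e'c'; exists (elim_le S), B; split=> //.
  have [|min std] := elementary_pair_elimination homA uniA _ elem' le_e'c'.
    by move=> i; rewrite inE supp.
  by apply: memB => //; case: elem'.
case/orP: (term_order_total le_order e c) => [le_ec|le_ce]; [left | right].
  exact: oriented.
rewrite opprB; apply: oriented => //; first exact: elementary_pairC.
by move=> i; rewrite addnC.
Qed.

Lemma universal_groebner_basis_toric p :
  up_to_sign (universal_groebner_basis I) p <-> up_to_sign (circuit (toric_ideal A)) p.
Proof.
split; first by case=> /universal_groebner_circuit; [left | right].
case=> /circuit_universal_groebner // [|]; first by right.
by rewrite opprK; left.
Qed.

End Universal.

(** * Circulations *)

Section Circulation.
Variables (T E : finType) (src dst : E -> T) (cap : E -> nat).
Hypothesis conservation : forall x,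
  (\sum_(e | src e == x) cap e = \sum_(e | dst e == x) cap e)%N.

(** Every arc carrying flow has a successor carrying flow. A minimal nonempty set S
    of such arcs stable under a choice of successors is permuted by it, so that the
    sources of the arcs of S are, with multiplicity, their targets: S is a union of
    cycles. *)
Lemma circulation_decomposition e0 : (0 < cap e0)%N ->
  exists S : {set E}, [/\ S != set0, forall e, e \in S -> (0 < cap e)%N &
    forall x, (\sum_(e | src e == x) (e \in S) = \sum_(e | dst e == x) (e \in S))%N].
Proof.
move=> cap_e0.
have next_ex e : exists e', (0 < cap e)%N ==> (0 < cap e')%N && (src e' == dst e).
  have [cap_e|] := ltnP 0 (cap e); last by exists e0.
  have: (0 < \sum_(e' | src e' == dst e) cap e')%N.
    by rewrite conservation (bigD1 e) //= ltn_addr.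
  rewrite lt0n sum_nat_eq0 negb_forall => /existsP[e'].
  by rewrite negb_imply -lt0n andbC => e'P; exists e'.
pose next e := xchoose (next_ex e).
have nextP e : (0 < cap e)%N -> (0 < cap (next e))%N /\ src (next e) = dst e.
  by move=> cap_e; have /implyP/(_ cap_e)/andP[? /eqP] := xchooseP (next_ex e).
pose stable (S : {set E}) :=
  [&& S != set0, S \subset [set e | 0 < cap e]%N & next @: S \subset S].
have [S /minsetP[/and3P[S_neq0 /subsetP S_cap S_next] minS]] : {S | minset stable S}.
  apply: ex_minset; exists [set e | 0 < cap e]%N; apply/and3P; split=> //.
    by apply/set0Pn; exists e0; rewrite inE.
  by apply/subsetP => _ /imsetP[e + ->]; rewrite !inE => /nextP[].
have next_S : next @: S = S.
  apply: (minS _ _ S_next); apply/and3P; split; last exact: imsetS.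
    by case/set0Pn: S_neq0 => e Se; apply/set0Pn; exists (next e); apply: imset_f.
  by apply: subset_trans S_next _; apply/subsetP.
have next_inj : {in S &, injective next} by apply/imset_injP; rewrite next_S.
exists S; split=> //; first by move=> e /S_cap; rewrite inE.
move=> x; have sumS (P : pred E) :
    (\sum_(e | P e) (e \in S) = \sum_(e in S) P e)%N.
  rewrite big_mkcond [RHS]big_mkcond; apply: eq_bigr => e _.
  by case: (P e); case: (e \in S).
rewrite !sumS -{1}next_S big_imset //=; apply: eq_bigr => e /S_cap.
by rewrite inE => /nextP[_ ->].
Qed.

End Circulation.

(** * The vector configuration of a graph *)

Section GraphConfiguration.
Variables (n m : nat) (G : sgraph n m).
Local Notation N := (n + (m + m))%N.
Local Notation diag := (var_diag m).
Local Notation up := (@var_up n m).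
Local Notation low := (@var_low n m).
Implicit Types (u v w : 'X_{1..N}) (h : 'I_m) (j : 'I_n).

Definition incident h j := ((edge G h).1 == j) || ((edge G h).2 == j).

Definition vertex_degree j u := (u (diag j) + \sum_(h | incident h j) u (up h))%N.

Lemma edge_neq h : (edge G h).1 != (edge G h).2.
Proof. by apply: contraTneq (edge_lt G h) => ->; rewrite ltnn. Qed.

Lemma graph_indexP (i : 'I_N) :
  (exists j, i = diag j) \/ (exists h, i = up h) \/ (exists h, i = low h).
Proof.
rewrite /var_diag /var_up /var_low -(splitK i).
case: (split i) => [j|w] /=; first by left; exists j.
right; rewrite -(splitK w); case: (split w) => h /=; first by left; exists h.
by right; exists h.
Qed.

Lemma big_graph_index (R : Type) (idx : R) (op : Monoid.com_law idx) (F : 'I_N -> R) :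
  \big[op/idx]_i F i = op (\big[op/idx]_j F (diag j))
    (op (\big[op/idx]_h F (up h)) (\big[op/idx]_h F (low h))).
Proof. by rewrite !big_split_ord. Qed.

Lemma mnm_deg_lshift u j : mnm_deg (A_config G) u 0 (lshift m j) = (vertex_degree j u)%:Z.
Proof.
rewrite /mnm_deg summxE big_graph_index /= [X in _ + (_ + X)]big1 => [|h _].
  rewrite addr0 /vertex_degree PoszD; congr (_ + _).
    rewrite (bigD1 j) //= big1 => [|k neq].
      by rewrite A_config_diag mulmxnE mxE !eqxx addr0 mulr1n natz.
    by rewrite A_config_diag mulmxnE mxE eqxx eq_lshift eq_sym (negPf neq) mul0rn.
  rewrite [RHS](big_morph Posz PoszD (erefl 0)) [RHS]big_mkcond; apply: eq_bigr => h _.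
  rewrite A_config_up mulmxnE !mxE !eqxx !eq_lshift eq_lrshift subr0 /incident.
  rewrite ![j == _]eq_sym; have := edge_neq h.
  have [<-|_] := eqVneq (edge G h).1 j; last first.
    by case: (_ == j) => _; rewrite /= ?mulr1n ?mulr0n ?add0r ?mul0rn ?natz.
  by rewrite eq_sym => /negPf->; rewrite /= mulr1n mulr0n addr0 natz.
by rewrite A_config_low mulmxnE mxE eqxx eq_lrshift mul0rn.
Qed.

Lemma mnm_deg_rshift u h :
  mnm_deg (A_config G) u 0 (rshift n h) = (u (low h))%:Z - (u (up h))%:Z.
Proof.
rewrite /mnm_deg summxE big_graph_index /= [X in X + _]big1 => [|j _].
  rewrite add0r addrC (bigD1 h) //= [X in _ + X + _]big1 => [|k neq]; last first.
    by rewrite A_config_low mulmxnE mxE eqxx eq_rshift eq_sym (negPf neq) mul0rn.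
  rewrite (bigD1 h) //= [X in _ + (_ + X)]big1 => [|k neq].
    rewrite A_config_low A_config_up !mulmxnE !mxE !eqxx !eq_rlshift.
    by rewrite /= ?mulr1n ?mulr0n !addr0 sub0r mulNrn !natz.
  rewrite A_config_up mulmxnE !mxE !eq_rlshift eq_rshift [h == k]eq_sym (negPf neq).
  by rewrite !andbF subr0 addr0 mul0rn.
by rewrite A_config_diag mulmxnE mxE eq_rlshift andbF mul0rn.
Qed.

(** In terms of w = u - v this says that the kernel lattice consists of the edge
    weights w (up h) = w (low h), the entry of w at a vertex being minus the sum of
    the weights of the incident edges. *)
Lemma graph_degP u v : mnm_deg (A_config G) u = mnm_deg (A_config G) v <->
  (forall j, vertex_degree j u = vertex_degree j v) /\
  (forall h, u (low h) + v (up h) = v (low h) + u (up h))%N.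
Proof.
split=> [deg_uv|[vert edg]].
  split=> [j|h]; apply/eqP; rewrite -eqz_nat; first by rewrite -!mnm_deg_lshift deg_uv.
  have := mnm_deg_rshift u h; rewrite deg_uv mnm_deg_rshift; lia.
apply/rowP => i; rewrite -(splitK i); case: (split i) => [j|h] /=.
  by rewrite !mnm_deg_lshift vert.
by rewrite !mnm_deg_rshift; move: (edg h); lia.
Qed.

Lemma sum_vertex_degree u :
  (\sum_j vertex_degree j u = \sum_j u (diag j) + (\sum_h u (up h)).*2)%N.
Proof.
rewrite big_split /=; congr addn.
rewrite (exchange_big_dep xpredT) //= -muln2 big_distrl; apply: eq_bigr => h _ /=.
rewrite sum_nat_const mulnC; congr muln.
rewrite (@eq_card _ _ (pred2 (edge G h).1 (edge G h).2)) ?card2 ?edge_neq //.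
by move=> j; rewrite [LHS]unfold_in !inE ![j == _]eq_sym.
Qed.

Lemma graph_homogeneous : homogeneous_config (A_config G).
Proof.
move=> u v /graph_degP[vert edg].
have: (\sum_j vertex_degree j u = \sum_j vertex_degree j v)%N by apply: eq_bigr.
have: (\sum_h (u (low h) + v (up h)) = \sum_h (v (low h) + u (up h)))%N by apply: eq_bigr.
rewrite !sum_vertex_degree !big_split !mdegE !big_graph_index /=; lia.
Qed.

End GraphConfiguration.

(** * Ideals given by generators *)

Section IdealGenerated.
Variables (R : comNzRingType) (F : R -> Prop).
Implicit Types p q : R.

Lemma ideal_gen0 : ideal_gen F 0.
Proof. by exists [::]; rewrite ?big_nil. Qed.

Lemma ideal_genD p q : ideal_gen F p -> ideal_gen F q -> ideal_gen F (p + q).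
Proof.
move=> [s Fs ->] [t Ft ->]; exists (s ++ t); last by rewrite big_cat.
by move=> c; rewrite mem_cat => /orP[/Fs|/Ft].
Qed.

Lemma ideal_genM p q : ideal_gen F q -> ideal_gen F (p * q).
Proof.
move=> [s Fs ->]; exists [seq (p * c.1, c.2) | c <- s].
  by move=> _ /mapP[c s_c ->] /=; apply: Fs.
by rewrite big_map mulr_sumr; apply: eq_bigr => c _; rewrite mulrA.
Qed.

Lemma ideal_gen_mem p : F p -> ideal_gen F p.
Proof.
move=> Fp; exists [:: (1, p)] => [c|]; last by rewrite big_seq1 mul1r.
by case: c => c1 c2; rewrite mem_seq1 => /eqP[_ ->].
Qed.

Lemma ideal_gen_congM p p' q q' : ideal_gen F (p - p') -> ideal_gen F (q - q') ->
  ideal_gen F (p * q - p' * q').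
Proof.
move=> Fp Fq; have -> : p * q - p' * q' = q * (p - p') + p' * (q - q').
  by rewrite !mulrBr [q * p]mulrC [q * p']mulrC addrA subrK.
by apply: ideal_genD; apply: ideal_genM.
Qed.

Lemma ideal_gen_congX p p' k : ideal_gen F (p - p') -> ideal_gen F (p ^+ k - p' ^+ k).
Proof. by move=> Fp; rewrite subrXX mulrC; apply: ideal_genM. Qed.

End IdealGenerated.

(** * The ideal of edge minors is toric *)

Section GraphIdeal.
Variables (K : fieldType) (n m : nat) (G : sgraph n m).
Local Notation N := (n + (m + m))%N.
Local Notation diag := (var_diag m).
Local Notation up := (@var_up n m).
Local Notation low := (@var_low n m).
Local Notation incident := (incident G).
Implicit Types (u v w : 'X_{1..N}) (h : 'I_m) (j : 'I_n) (t : 'I_m -> nat).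

Definition edge_diag h : 'X_{1..N} := (U_(diag (edge G h).1) + U_(diag (edge G h).2))%MM.
Definition edge_offdiag h : 'X_{1..N} := (U_(up h) + U_(low h))%MM.

Lemma P_ideal_exchange t w : P_ideal K G
  ('X_[w + \sum_h edge_diag h *+ t h] - 'X_[w + \sum_h edge_offdiag h *+ t h]).
Proof.
rewrite !mpolyXD -mulrBr; apply: ideal_genM; rewrite -!mprodXE.
elim/big_rec2: _ => [|h p q _ Pqp]; first by rewrite subrr; apply: ideal_gen0.
apply: ideal_gen_congM => //; rewrite -!mpolyXn; apply/ideal_gen_congX/ideal_gen_mem.
by exists h; rewrite !mpolyXD.
Qed.

Lemma mnm_edge_offdiag t (i : 'I_N) : (\sum_h edge_offdiag h *+ t h)%MM i =
  (\sum_h ((up h == i) + (low h == i)) * t h)%N.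
Proof. by rewrite mnm_sumE; apply: eq_bigr => h _; rewrite mulmnE mnmDE !mnm1E. Qed.

Lemma mnm_edge_diag t (i : 'I_N) : (\sum_h edge_diag h *+ t h)%MM i =
  (\sum_h ((diag (edge G h).1 == i) + (diag (edge G h).2 == i)) * t h)%N.
Proof. by rewrite mnm_sumE; apply: eq_bigr => h _; rewrite mulmnE mnmDE !mnm1E. Qed.

Lemma graph_index_eq :
  [/\ forall j j', (diag j == diag j') = (j == j'), forall j h, (diag j == up h) = false,
      forall j h, (diag j == low h) = false & forall h h', (up h == low h') = false] *
  [/\ forall h h', (up h == up h') = (h == h'), forall h h', (low h == low h') = (h == h'),
      forall j h, (up h == diag j) = false, forall j h, (low h == diag j) = false
      & forall h h', (low h' == up h) = false].
Proof.
by split; split=> *; rewrite /var_diag /var_up /var_low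
  ?(eq_lshift, eq_rshift, eq_lrshift, eq_rlshift).
Qed.

(** Exchanging x_kl x_lk for x_kk x_ll as often as the exponent of x_kl in one
    monomial exceeds that in the other leads from both monomials to a common
    one. *)
Lemma P_ideal_binomial u v : mnm_deg (A_config G) u = mnm_deg (A_config G) v ->
  P_ideal K G ('X_[u] - 'X_[v]).
Proof.
move=> /graph_degP[vert edg].
have [[dd du dl ul] [uu ll ud ld lu]] := graph_index_eq.
have off_diag t j : (\sum_h edge_offdiag h *+ t h)%MM (diag j) = 0%N.
  by rewrite mnm_edge_offdiag big1 // => h _; rewrite ud ld.
have off_up t h : (\sum_h edge_offdiag h *+ t h)%MM (up h) = t h.
  rewrite mnm_edge_offdiag (bigD1 h) //= big1 => [|k /negPf neq].
    by rewrite uu lu eqxx mul1n addn0.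
  by rewrite uu lu neq.
have off_low t h : (\sum_h edge_offdiag h *+ t h)%MM (low h) = t h.
  rewrite mnm_edge_offdiag (bigD1 h) //= big1 => [|k /negPf neq].
    by rewrite ll ul eqxx mul1n addn0.
  by rewrite ll ul neq.
have diag_diag t j : (\sum_h edge_diag h *+ t h)%MM (diag j) = (\sum_(h | incident h j) t h)%N.
  rewrite mnm_edge_diag [RHS]big_mkcond; apply: eq_bigr => h _; rewrite !dd /incident.
  have := edge_neq G h; have [->|_] := eqVneq (edge G h).1 j.
    by rewrite eq_sym => /negPf->; rewrite mul1n.
  by case: (_ == j) => _; rewrite ?mul1n ?mul0n.
have diag_up t h : (\sum_h edge_diag h *+ t h)%MM (up h) = 0%N.
  by rewrite mnm_edge_diag big1 // => k _; rewrite !du.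
have diag_low t h : (\sum_h edge_diag h *+ t h)%MM (low h) = 0%N.
  by rewrite mnm_edge_diag big1 // => k _; rewrite !dl.
pose t h := (u (up h) - v (up h))%N; pose t' h := (v (up h) - u (up h))%N.
pose w := (u - \sum_h edge_offdiag h *+ t h)%MM.
pose w' := (v - \sum_h edge_offdiag h *+ t' h)%MM.
have def_u : u = (w + \sum_h edge_offdiag h *+ t h)%MM.
  rewrite submK //; apply/mnm_lepP => i; case: (graph_indexP i) => [[j ->]|[[h ->]|[h ->]]];
    rewrite ?off_diag ?off_up ?off_low // /t; move: (edg h); lia.
have def_v : v = (w' + \sum_h edge_offdiag h *+ t' h)%MM.
  rewrite submK //; apply/mnm_lepP => i; case: (graph_indexP i) => [[j ->]|[[h ->]|[h ->]]];
    rewrite ?off_diag ?off_up ?off_low // /t'; move: (edg h); lia.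
have eq_w : (w + \sum_h edge_diag h *+ t h)%MM = (w' + \sum_h edge_diag h *+ t' h)%MM.
  apply/mnmP => i; rewrite /w /w' !mnmDE !mnmBE.
  case: (graph_indexP i) => [[j ->]|[[h ->]|[h ->]]];
    rewrite ?off_diag ?off_up ?off_low ?diag_diag ?diag_up ?diag_low; last first.
  - by rewrite /t /t'; move: (edg h); lia.
  - by rewrite /t /t'; lia.
  have: (\sum_(h | incident h j) (t h + v (up h)) =
         \sum_(h | incident h j) (t' h + u (up h)))%N.
    by apply: eq_bigr => h _; rewrite /t /t'; lia.
  rewrite !big_split /= !subn0.
  have arith a b s s' x y : (a + x = b + y -> s + y = s' + x -> a + s = b + s')%N by lia.
  exact: arith (vert j).
have -> : 'X_[u] - 'X_[v] = ('X_[w' + \sum_h edge_diag h *+ t' h] - 'X_[v])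
    + (-1) * ('X_[w + \sum_h edge_diag h *+ t h] - 'X_[u]) :> {mpoly K[N]}.
  by rewrite eq_w mulN1r opprB [RHS]addrC addrA subrK.
apply: ideal_genD; last apply: ideal_genM; first by rewrite {1}def_v; apply: P_ideal_exchange.
by rewrite {1}def_u; apply: P_ideal_exchange.
Qed.

Lemma edge_minor_toric h : toric_ideal (A_config G) (edge_minor K G h).
Proof.
rewrite /edge_minor -!mpolyXD; apply: toric_binomial; rewrite !mnm_degD.
have degU i : mnm_deg (A_config G) U_(i) = A_config G i.
  rewrite /mnm_deg (bigD1 i) //= mnm1E eqxx mulr1n big1 ?addr0 // => k neq.
  by rewrite mnm1E eq_sym (negPf neq).
by rewrite !degU !A_config_diag A_config_up A_config_low subrK.
Qed.

(** A toric ideal is spanned by its binomials: the support of p shrinks when a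
    monomial is replaced by another one of p in the same fibre. *)
Lemma P_idealE p : P_ideal K G p <-> toric_ideal (A_config G) p.
Proof.
split=> [[s Ps ->]|].
  rewrite big_seq; apply: (big_ind (toric_ideal (A_config G))) => [|q r tq tr|c s_c].
  - exact: toric_ideal0.
  - by rewrite -[r]opprK -[- r]sub0r; do 2!apply: toric_idealB => //; apply: toric_ideal0.
  by apply: toric_idealM; have [h ->] := Ps c s_c; apply: edge_minor_toric.
have [k] := ubnP (size (msupp p)); elim: k p => // k IH p le_pk toric_p.
have [->|nz] := eqVneq p 0; first exact: ideal_gen0.
have [u p_u] : exists u, u \in msupp p.
  by move: nz; rewrite -msupp_eq0; case: (msupp p) => // u s _; exists u; apply: mem_head.
have [v [p_v neq deg_v]] := toric_ideal_partner toric_p p_u.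
pose b : {mpoly K[N]} := (p@_u)%:MP * ('X_[u] - 'X_[v]).
have -> : p = (p - b) + b by rewrite subrK.
apply: ideal_genD; last exact/ideal_genM/P_ideal_binomial.
apply: IH; last first.
  by apply: toric_idealB => //; apply/toric_idealM/toric_binomial.
rewrite ltnS in le_pk; apply: leq_trans le_pk.
have coeff_b w : (p - b)@_w = p@_w - p@_u * ((u == w)%:R - (v == w)%:R).
  by rewrite mcoeffB mcoeffCM mcoeff_binomial.
suff sub : {subset msupp (p - b) <= rem u (msupp p)}.
  have := uniq_leq_size (msupp_uniq _) sub; rewrite size_rem //.
  by case: (msupp p) p_u.
move=> w; rewrite mem_rem_uniq ?msupp_uniq // inE !mcoeff_msupp coeff_b.
have [->|_] := eqVneq w u; first by rewrite (negPf neq) subr0 mulr1 subrr eqxx.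
rewrite /=; have [<-|_] := eqVneq v w; first by rewrite -mcoeff_msupp.
by rewrite subrr mulr0 subr0.
Qed.

End GraphIdeal.

(** * Unimodularity for bipartite graphs *)

Section BipartiteCirculations.
Variables (n m : nat) (G : sgraph n m) (V : {set 'I_n}).
Hypothesis bipV : forall h, ((edge G h).1 \in V) != ((edge G h).2 \in V).
Local Notation N := (n + (m + m))%N.
Local Notation diag := (var_diag m).
Local Notation up := (@var_up n m).
Local Notation low := (@var_low n m).
Local Notation incident := (incident G).
Local Notation arc := (bool * ('I_n + 'I_m))%type.
Implicit Types (u v w : 'X_{1..N}) (h : 'I_m) (j : 'I_n).

(** The network has the vertices of G and a vertex None at infinity. The variable
    x_jj is an arc joining j to infinity and an edge is an arc joining its ends;
    both are directed away from V, or away from infinity if they do not meet V. The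
    boolean of an arc tells whether it is used in this direction or backwards. *)
Definition arc_ends (x : 'I_n + 'I_m) : option 'I_n * option 'I_n :=
  match x with
  | inl j => if j \in V then (Some j, None) else (None, Some j)
  | inr h => if (edge G h).1 \in V then (Some (edge G h).1, Some (edge G h).2)
             else (Some (edge G h).2, Some (edge G h).1)
  end.
Definition arc_src (a : arc) := if a.1 then (arc_ends a.2).1 else (arc_ends a.2).2.
Definition arc_dst (a : arc) := if a.1 then (arc_ends a.2).2 else (arc_ends a.2).1.

Definition arc_degree (F : arc -> nat) b j :=
  (F (b, inl j) + \sum_(h | incident h j) F (b, inr h))%N.

Lemma sum_arcs (F : arc -> nat) (P : pred arc) :
  (\sum_(a | P a) F a =
   \sum_(x | P (true, x)) F (true, x) + \sum_(x | P (false, x)) F (false, x))%N.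
Proof.
transitivity (\sum_b \sum_(x | P (b, x)) F (b, x))%N; last by rewrite big_bool.
by rewrite pair_big_dep /=; apply: eq_big => [[]|[]].
Qed.

Lemma arc_ends_diag j k :
  ((arc_ends (inl k)).1 == Some j) = (k == j) && (j \in V) /\
  ((arc_ends (inl k)).2 == Some j) = (k == j) && (j \notin V).
Proof.
rewrite /=; case: ifP => Vk /=; split=> //; have [<-|neq] := eqVneq k j;
  by rewrite ?Vk ?eqxx //= (inj_eq Some_inj) (negPf neq).
Qed.

Lemma arc_ends_edge j h :
  ((arc_ends (inr h)).1 == Some j) = incident h j && (j \in V) /\
  ((arc_ends (inr h)).2 == Some j) = incident h j && (j \notin V).
Proof.
rewrite /incident /=; have := bipV h; move: (edge G h).1 (edge G h).2 => k l.
have Vk : (k == j) ==> ((j \in V) == (k \in V)) by apply/implyP => /eqP->.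
have Vl : (l == j) ==> ((j \in V) == (l \in V)) by apply/implyP => /eqP->.
move: Vk Vl; case: (k \in V); case: (l \in V) => //=; rewrite !(inj_eq Some_inj);
  by case: (j \in V); case: (k == j); case: (l == j).
Qed.

Lemma sum_arc_ends (f : 'I_n + 'I_m -> nat) j :
  let d := (f (inl j) + \sum_(h | incident h j) f (inr h))%N in
  (\sum_(x | (arc_ends x).1 == Some j) f x = if j \in V then d else 0)%N /\
  (\sum_(x | (arc_ends x).2 == Some j) f x = if j \in V then 0 else d)%N.
Proof.
have sum_if (side : option 'I_n * option 'I_n -> option 'I_n) (b : bool) :
    (forall k, (side (arc_ends (inl k)) == Some j) = (k == j) && b) ->
    (forall h, (side (arc_ends (inr h)) == Some j) = incident h j && b) ->
    (\sum_(x | side (arc_ends x) == Some j) f x =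
     if b then f (inl j) + \sum_(h | incident h j) f (inr h) else 0)%N.
  move=> diagE edgeE; rewrite big_sumType (eq_bigl _ _ diagE) (eq_bigl _ _ edgeE).
  case: b {diagE edgeE}; last by rewrite !big_pred0 // => k; rewrite andbF.
  rewrite (eq_bigl (pred1 j)) ?big_pred1_eq => [|k]; last by rewrite andbT.
  by congr addn; apply: eq_bigl => h; rewrite andbT.
split.
  by apply: (sum_if fst) => [k|h]; [case: (arc_ends_diag j k) | case: (arc_ends_edge j h)].
rewrite -if_neg.
by apply: (sum_if snd) => [k|h]; [case: (arc_ends_diag j k) | case: (arc_ends_edge j h)].
Qed.

(** Bipartiteness enters here: the arcs at a vertex all leave it, or all enter it,
    so that the conservation of flow at j compares the total weight at j of the
    direct arcs and of the reversed ones, as equality of multidegrees does. *)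
Lemma arc_conservation (F : arc -> nat) j :
  (\sum_(a | arc_src a == Some j) F a = \sum_(a | arc_dst a == Some j) F a)%N <->
  arc_degree F true j = arc_degree F false j.
Proof.
rewrite !sum_arcs /arc_src /arc_dst /=.
have [-> ->] := sum_arc_ends (fun x => F (true, x)) j.
have [-> ->] := sum_arc_ends (fun x => F (false, x)) j.
rewrite -!/(arc_degree F _ j); case: ifP => _; rewrite ?addn0 ?add0n //.
by split=> ->.
Qed.

(** Summing over all vertices, the total outflow is the total inflow. *)
Lemma arc_conservation_infinity (F : arc -> nat) :
  (forall j, \sum_(a | arc_src a == Some j) F a = \sum_(a | arc_dst a == Some j) F a)%N ->
  (\sum_(a | arc_src a == None) F a = \sum_(a | arc_dst a == None) F a)%N.
Proof.
move=> cons.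
have total (s : arc -> option 'I_n) : (\sum_(x : option 'I_n) \sum_(a | s a == x) F a = \sum_a F a)%N.
  rewrite (exchange_big_dep xpredT) //=; apply: eq_bigr => a _.
  by rewrite (big_pred1 (s a)).
have := etrans (total arc_src) (esym (total arc_dst)).
rewrite (bigD1 None) //= [X in _ = X](bigD1 None) //=.
rewrite (eq_bigr (fun x => \sum_(a | arc_dst a == x) F a)%N); first exact: addIn.
by case.
Qed.

(** The lattice vector u - v as a flow: its positive part runs along the arcs, its
    negative part against them. *)
Definition arc_flow u v (a : arc) : nat :=
  let i := match a.2 with inl j => diag j | inr h => up h end in
  if a.1 then (u i - v i)%N else (v i - u i)%N.

Definition arc_monomial (b : bool) (S : {set arc}) : 'X_{1..N} :=
  [multinom match split i with
            | inl j => nat_of_bool ((b, inl j) \in S)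
            | inr w => match split w with inl h | inr h => nat_of_bool ((b, inr h) \in S) end
            end | i < N].
Lemma arc_monomialE b S :
  [/\ forall j, arc_monomial b S (diag j) = ((b, inl j) \in S),
      forall h, arc_monomial b S (up h) = ((b, inr h) \in S)
    & forall h, arc_monomial b S (low h) = ((b, inr h) \in S)].
Proof.
split=> *; rewrite mnmE /var_diag /var_up /var_low.
- by rewrite (unsplitK (inl _)).
- by rewrite (unsplitK (inr _)) (unsplitK (inl _)).
by rewrite (unsplitK (inr _)) (unsplitK (inr _)).
Qed.

(** A union of cycles inside the flow of u - v uses each arc at most once, and never
    in both directions; read back as a lattice vector, it has entries 0, 1, -1. *)
Lemma bipartite_unimodular : unimodular_config (A_config G).
Proof.
move=> u v deg_uv neq; have [vert edg] := proj1 (graph_degP G u v) deg_uv.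
have cons x : (\sum_(a | arc_src a == x) arc_flow u v a =
               \sum_(a | arc_dst a == x) arc_flow u v a)%N.
  have inner j : (\sum_(a | arc_src a == Some j) arc_flow u v a =
                  \sum_(a | arc_dst a == Some j) arc_flow u v a)%N.
    apply/arc_conservation; rewrite /arc_degree /arc_flow /=.
    have := vert j; rewrite /vertex_degree.
    have: (\sum_(h | incident h j) (u (up h) - v (up h) + v (up h)) =
           \sum_(h | incident h j) (v (up h) - u (up h) + u (up h)))%N.
      by apply: eq_bigr => h _; lia.
    rewrite !big_split /=.
    have arith a b s s' y z : (s + z = s' + y -> a + y = b + z -> a - b + s = b - a + s')%N by lia.
    exact: arith.
  by case: x => [j|]; [apply: inner | apply: arc_conservation_infinity].
have [a0 flow_a0] : exists a, (0 < arc_flow u v a)%N.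
  have [i nzi] : exists i, u i != v i.
    apply/existsP; rewrite -negb_forall; apply: contra neq => /forallP eq_uv.
    by apply/eqP/mnmP => j; apply/eqP.
  case: (graph_indexP i) nzi => [[j ->]|[[h ->]|[h ->]]] nz.
  - exists (v (diag j) < u (diag j), inl j)%N; rewrite /arc_flow /=; case: (ltnP (v _) (u _)); lia.
  - exists (v (up h) < u (up h), inr h)%N; rewrite /arc_flow /=; case: (ltnP (v _) (u _)); lia.
  exists (v (up h) < u (up h), inr h)%N; rewrite /arc_flow /=.
  by move: (edg h); case: (ltnP (v _) (u _)); lia.
have [S [S_neq0 S_flow S_cons]] := circulation_decomposition cons flow_a0.
have S_one i x : (i = match x with inl j => diag j | inr h => up h end) ->
    [/\ ((true, x) \in S) <= u i - v i & ((false, x) \in S) <= v i - u i]%N.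
  by move=> ->; split; case: (boolP (_ \in S)) => // /S_flow; case: x.
have [Td Tu Tl] := arc_monomialE true S; have [Fd Fu Fl] := arc_monomialE false S.
exists (arc_monomial true S), (arc_monomial false S); split.
- apply/mnm_lepP => i; case: (graph_indexP i) => [[j ->]|[[h ->]|[h ->]]].
  + by rewrite Td; case: (S_one _ (inl j) erefl) => /=; do 2!case: (_ \in S) => /=; lia.
  + by rewrite Tu; case: (S_one _ (inr h) erefl) => /=; do 2!case: (_ \in S) => /=; lia.
  by rewrite Tl; case: (S_one _ (inr h) erefl) => /=; move: (edg h); do 2!case: (_ \in S) => /=; lia.
- apply/mnm_lepP => i; case: (graph_indexP i) => [[j ->]|[[h ->]|[h ->]]].
  + by rewrite Fd; case: (S_one _ (inl j) erefl) => /=; do 2!case: (_ \in S) => /=; lia.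
  + by rewrite Fu; case: (S_one _ (inr h) erefl) => /=; do 2!case: (_ \in S) => /=; lia.
  by rewrite Fl; case: (S_one _ (inr h) erefl) => /=; move: (edg h); do 2!case: (_ \in S) => /=; lia.
- case/set0Pn: S_neq0 => -[b x] Sbx; apply/eqP => /mnmP eqTF.
  have eqS : ((true, x) \in S) = ((false, x) \in S).
    case: x {Sbx} => y; [have := eqTF (diag y) | have := eqTF (up y)];
      by rewrite ?Td ?Fd ?Tu ?Fu; do 2!case: (_ \in S).
  have [] := S_one _ x erefl; rewrite eqS.
  have -> : (false, x) \in S by case: b Sbx; rewrite ?eqS.
  by move: (u _) (v _) => k l; lia.
- apply/graph_degP; split=> [j|h]; last by rewrite Tl Fl Tu Fu addnC.
  rewrite /vertex_degree Td Fd; under eq_bigr do rewrite Tu.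
  under [in RHS]eq_bigr do rewrite Fu.
  exact/(arc_conservation (fun a => a \in S) j).
move=> i; case: (graph_indexP i) => [[j ->]|[[h ->]|[h ->]]].
+ by rewrite Td Fd; case: (S_one _ (inl j) erefl) => /=; do 2!case: (_ \in S) => /=; lia.
+ by rewrite Tu Fu; case: (S_one _ (inr h) erefl) => /=; do 2!case: (_ \in S) => /=; lia.
by rewrite Tl Fl; case: (S_one _ (inr h) erefl) => /=; do 2!case: (_ \in S) => /=; lia.
Qed.

End BipartiteCirculations.

Theorem theorem2p6 (K : fieldType) (n m : nat) (G : sgraph n m) :
  bipartite G ->
  (forall le : rel 'X_{1..n + (m + m)}, term_order le ->
     generated_by_squarefree_monomials (initial_ideal le (P_ideal K G)))
  /\
  (forall p : {mpoly K[n + (m + m)]},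
     up_to_sign (universal_groebner_basis (P_ideal K G)) p <->
     up_to_sign (circuit (toric_ideal (A_config G))) p).
Proof.
case=> V bipV; have homA := graph_homogeneous (G := G).
have uniA := bipartite_unimodular bipV.
split=> [le le_order|p].
  exact: (initial_ideal_squarefree homA uniA (@P_idealE K n m G) le_order).
exact: (universal_groebner_basis_toric homA uniA (@P_idealE K n m G)).
Qed.
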